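(* There is a unique formal series solution of the symmetric $q$-$P(A_1)$ equation of the form $$x^{0,+}=\sum_{n\ge1}\sum_{i\le n}x^{0,+}_{n,i}(\Lambda_s,\xi,\mathbf b_s)t^n\phi_s^i,\qquad x^{0,+}_{1,1}=1.$$ Each coefficient $x^{0,+}_{n,i}$ is a rational function of $(\Lambda_s,\xi,\mathbf b_s)$, regular at every $(\Lambda_s,\xi,\mathbf b_s)\in\mathbb C^*\times\mathbb C^*\times\mathcal B_s$ with $1\notin\{q_1^mq_2^n:(m,n)\in\mathbb N^2\setminus\{(0,0)\}\}$, where $q_1=\xi\Lambda_s$, $q_2=\Lambda_s^{-1}$. Moreover, if $|\xi|<1$ and $\Lambda_s\in L_0^s:=\{x\in\mathbb C:1<|x|<|\xi|^{-1}\}$, this condition holds and the series $\sum_{n\ge1}\sum_{m\ge0}x^{0,+}_{n,n-m}(\Lambda_s,\xi,\mathbf b_s)\zeta_1^n\zeta_2^m$ (with $\zeta_1=t\phi_s$, $\zeta_2=\phi_s^{-1}$) converges near $(\zeta_1,\zeta_2)=(0,0)$; more precisely, for every open $L$ with $\overline L\subseteq L_0^s$ there is an open neighbourhood $Z\subseteq\mathbb C^2$ of $\mathbf 0$ on which, uniformly for $(\zeta,\Lambda_s)\in Z\times L$, it converges to a holomorphic function of $(\zeta_1,\zeta_2,\Lambda_s)$.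
   Context: $\mathcal B_s=\{\mathbf b_s=(a,b,c,d)\in\mathbb C^4:a,b,c,d\neq0\}$, $\xi\in\mathbb C^*$. The symmetric $q$-$P(A_1)$ equation for $x=x(t)$ is $$\frac{(x\hat x-\xi t^2)(x\check x-\xi^{-1}t^2)}{(x\hat x-1)(x\check x-1)}=\frac{(x-at)(x-a^{-1}t)(x-bt)(x-b^{-1}t)}{(x-c)(x-c^{-1})(x-d)(x-d^{-1})},$$ with $\hat x=x(\xi t)$, $\check x=x(\xi^{-1}t)$ (understood after clearing denominators). Formal setting: $\Lambda_s,\phi_s$ are indeterminates; the shift $\hat\cdot$ acts by $t\mapsto\xi t$, $\phi_s\mapsto\Lambda_s\phi_s$, $\Lambda_s\mapsto\Lambda_s$, so for $x=\sum_{n\ge1}x_n(\phi_s)t^n$ with $x_n(\phi_s)=\sum_{i\le n}x_{n,i}\phi_s^i$ one has $\hat x=\sum_n\xi^nx_n(\Lambda_s\phi_s)t^n$, $\check x=\sum_n\xi^{-n}x_n(\Lambda_s^{-1}\phi_s)t^n$. A formal series solution is such an $x$ satisfying the (denominator-cleared) equation identically as formal series in $t$ with Laurent-series-in-$\phi_s$ coefficients. *)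

(* Defs.v *)
From Stdlib Require Import Reals.
Open Scope R_scope.

Record Cx : Type := mkC { re : R ; im : R }.

Definition Czero : Cx := mkC 0 0.
Definition Cone : Cx := mkC 1 0.
Definition Cadd (z w : Cx) : Cx := mkC (re z + re w) (im z + im w).
Definition Copp (z : Cx) : Cx := mkC (- re z) (- im z).
Definition Csub (z w : Cx) : Cx := Cadd z (Copp w).
Definition Cmul (z w : Cx) : Cx :=
  mkC (re z * re w - im z * im w) (re z * im w + im z * re w).
Definition Cinv (z : Cx) : Cx :=
  mkC (re z / (re z * re z + im z * im z)) (- im z / (re z * re z + im z * im z)).
Definition Cdiv (z w : Cx) : Cx := Cmul z (Cinv w).
Definition Cnorm (z : Cx) : R := sqrt (re z * re z + im z * im z).
Fixpoint Cpow (z : Cx) (n : nat) : Cx :=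
  match n with O => Cone | S k => Cmul z (Cpow z k) end.
Fixpoint Csum (f : nat -> Cx) (n : nat) : Cx :=
  match n with O => f O | S k => Cadd (Csum f k) (f (S k)) end.

(** * Formal series in t with Laurent-series-in-phi coefficients.
    A series [f : FS] represents  sum_{n>=0} sum_{m>=0} f n m * t^n * phi^(n-m),
    i.e. the coefficient of t^n phi^i is f n (n-i)  (only powers i <= n occur).
    This is closed under the operations needed (constants, t, products, shifts). *)
Definition FS := nat -> nat -> Cx.

Definition fconst (c : Cx) : FS :=
  fun n m => match n, m with O, O => c | _, _ => Czero end.
(** the series t = t^1 phi^0, i.e. n = 1, m = 1 *)
Definition ft : FS :=
  fun n m => match n, m with 1%nat, 1%nat => Cone | _, _ => Czero end.
Definition fadd (f g : FS) : FS := fun n m => Cadd (f n m) (g n m).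
Definition fsub (f g : FS) : FS := fun n m => Csub (f n m) (g n m).
Definition fscale (c : Cx) (f : FS) : FS := fun n m => Cmul c (f n m).
Definition fmul (f g : FS) : FS :=
  fun n m => Csum (fun k => Csum (fun l => Cmul (f k l) (g (n - k)%nat (m - l)%nat)) m) n.

(** shift  t -> xi t, phi -> Lam phi : the monomial t^n phi^(n-m) is multiplied
    by xi^n Lam^(n-m) = xi^n Lam^n (Lam^-1)^m *)
Definition fhat (Lam xi : Cx) (f : FS) : FS :=
  fun n m => Cmul (Cmul (Cpow xi n) (Cmul (Cpow Lam n) (Cpow (Cinv Lam) m))) (f n m).
(** inverse shift  t -> xi^-1 t, phi -> Lam^-1 phi *)
Definition fcheck (Lam xi : Cx) (f : FS) : FS :=
  fun n m => Cmul (Cmul (Cpow (Cinv xi) n) (Cmul (Cpow (Cinv Lam) n) (Cpow Lam m))) (f n m).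

Definition is_xseries (x : FS) : Prop := forall m, x O m = Czero.

(** Denominator-cleared symmetric q-P(A1) equation, as an identity of formal series:
   (x xh - xi t^2)(x xc - xi^-1 t^2)(x-c)(x-c^-1)(x-d)(x-d^-1)
 = (x xh - 1)(x xc - 1)(x-a t)(x-a^-1 t)(x-b t)(x-b^-1 t)            *)
Definition qPA1_formal (Lam xi a b c d : Cx) (x : FS) : Prop :=
  let xh := fhat Lam xi x in
  let xc := fcheck Lam xi x in
  let t2 := fmul ft ft in
  let lhs :=
    fmul (fmul (fmul (fmul (fmul
      (fsub (fmul x xh) (fscale xi t2))
      (fsub (fmul x xc) (fscale (Cinv xi) t2)))
      (fsub x (fconst c))) (fsub x (fconst (Cinv c))))
      (fsub x (fconst d))) (fsub x (fconst (Cinv d))) in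
  let rhs :=
    fmul (fmul (fmul (fmul (fmul
      (fsub (fmul x xh) (fconst Cone))
      (fsub (fmul x xc) (fconst Cone)))
      (fsub x (fscale a ft))) (fsub x (fscale (Cinv a) ft)))
      (fsub x (fscale b ft))) (fsub x (fscale (Cinv b) ft)) in
  forall n m, lhs n m = rhs n m.

Definition nonresonant (Lam xi : Cx) : Prop :=
  forall m n : nat, (m, n) <> (O, O) ->
    Cmul (Cpow (Cmul xi Lam) m) (Cpow (Cinv Lam) n) <> Cone.

Definition Dom (Lam xi a b c d : Cx) : Prop :=
  Lam <> Czero /\ xi <> Czero /\ a <> Czero /\ b <> Czero /\ c <> Czero /\ d <> Czero /\
  nonresonant Lam xi.

Inductive cpoly : Type :=
| PV : nat -> cpoly          (* variable number k: 0=Lam,1=xi,2=a,3=b,4=c,5=d *)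
| PC : Cx -> cpoly
| PAdd : cpoly -> cpoly -> cpoly
| PMul : cpoly -> cpoly -> cpoly
| POpp : cpoly -> cpoly.

Fixpoint peval (v : nat -> Cx) (p : cpoly) : Cx :=
  match p with
  | PV k => v k
  | PC c => c
  | PAdd p q => Cadd (peval v p) (peval v q)
  | PMul p q => Cmul (peval v p) (peval v q)
  | POpp p => Copp (peval v p)
  end.

Definition env6 (Lam xi a b c d : Cx) : nat -> Cx :=
  fun k => match k with
           | O => Lam | 1%nat => xi | 2%nat => a | 3%nat => b | 4%nat => c | _ => d end.

Definition rational_regular_on (D : Cx -> Cx -> Cx -> Cx -> Cx -> Cx -> Prop)
  (F : Cx -> Cx -> Cx -> Cx -> Cx -> Cx -> Cx) : Prop :=
  exists P Q : cpoly,
    forall Lam xi a b c d, D Lam xi a b c d ->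
      peval (env6 Lam xi a b c d) Q <> Czero /\
      F Lam xi a b c d = Cdiv (peval (env6 Lam xi a b c d) P) (peval (env6 Lam xi a b c d) Q).

Definition C_open (L : Cx -> Prop) : Prop :=
  forall z, L z -> exists r, 0 < r /\ forall w, Cnorm (Csub w z) < r -> L w.
Definition C_closure (L : Cx -> Prop) (z : Cx) : Prop :=
  forall eps, 0 < eps -> exists w, L w /\ Cnorm (Csub w z) < eps.
Definition C2_open (Z : Cx -> Cx -> Prop) : Prop :=
  forall z1 z2, Z z1 z2 -> exists r, 0 < r /\
    forall w1 w2, Cnorm (Csub w1 z1) < r -> Cnorm (Csub w2 z2) < r -> Z w1 w2.

Definition L0 (xi : Cx) (z : Cx) : Prop := 1 < Cnorm z < / Cnorm xi.

Definition holomorphic_on3 (U : Cx -> Cx -> Cx -> Prop) (f : Cx -> Cx -> Cx -> Cx) : Prop :=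
  forall z1 z2 z3, U z1 z2 z3 ->
    exists D1 D2 D3 : Cx, forall eps, 0 < eps -> exists delta, 0 < delta /\
      forall h1 h2 h3, Cnorm h1 < delta -> Cnorm h2 < delta -> Cnorm h3 < delta ->
        Cnorm (Csub (Csub (f (Cadd z1 h1) (Cadd z2 h2) (Cadd z3 h3)) (f z1 z2 z3))
                    (Cadd (Cadd (Cmul D1 h1) (Cmul D2 h2)) (Cmul D3 h3)))
        <= eps * (Cnorm h1 + Cnorm h2 + Cnorm h3).

Definition unif_conv3 (U : Cx -> Cx -> Cx -> Prop) (S : nat -> Cx -> Cx -> Cx -> Cx)
  (f : Cx -> Cx -> Cx -> Cx) : Prop :=
  forall eps, 0 < eps -> exists N0 : nat, forall N : nat, (N0 <= N)%nat ->
    forall z1 z2 z3, U z1 z2 z3 -> Cnorm (Csub (S N z1 z2 z3) (f z1 z2 z3)) < eps.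

Definition psum2 (X : nat -> nat -> Cx) (N : nat) (z1 z2 : Cx) : Cx :=
  Csum (fun n => Csum (fun m => Cmul (X n m) (Cmul (Cpow z1 n) (Cpow z2 m))) N) N.

(* Main.v *)
Require Import Defs.
From Stdlib Require Import Reals Lra Lia.
From Stdlib Require Import FunctionalExtensionality ClassicalEpsilon.
From Coquelicot Require Complex Compactness.
Open Scope R_scope.

(* Put zeta1 = t phi, zeta2 = 1/phi, so that t = zeta1 zeta2 and the shift
   multiplies zeta1 by q1 = xi Lam and zeta2 by q2 = 1/Lam.  Writing
   x = zeta1 (1 + v) and applying one forward shift, the equation becomes, after
   division by (q1 zeta1)^4,
     v - 2 v^ + v^^ + H(zeta1, zeta2, v, v^, v^^) = 0,
   where every monomial of H contains zeta1 or zeta2 or is at least quadratic in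
   v, v^, v^^.  On zeta1^n zeta2^m the linear part is multiplication by
   (1 - q1^n q2^m)^2, so the coefficients of v are determined recursively as
   rational functions.  If |q1|, |q2| < 1, these multipliers are bounded away
   from 0 and shifts do not increase coefficients, so a small ball for the
   weighted norm sup |v_{n,m}| (n+1)^2 (m+1)^2 r^{-n-m} is invariant under the
   iteration.  Running the same estimate in an algebra of functions of Lam whose
   norm also controls derivatives and second-order Taylor remainders gives the
   joint holomorphy of the sum without Cauchy's formula. *)

(** The forward shift is what makes estimates possible: the backward shift multiplies the
    coefficient of zeta1^n zeta2^m by q1^-n q2^-m, which is unbounded, whereas afterwards only
    dilations by q1 and q2 occur. With U0, U1, U2 = 1 + v, 1 + v^, 1 + v^^, setting the explicit
    zeta1 and zeta2 to 0 in the divided equation leaves U1^2 (U0 U2 - U1^2); its linearization at U0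
    = U1 = U2 = 1 acts on a monomial by 1 - 2Q + Q^2 with Q = q1^n q2^m, hence the square. H is kept
    as a syntax tree, so that the triangularity of the recursion, the rationality of the
    coefficients and the norm bounds are each a structural induction instead of a computation with a
    long polynomial. Invariance of a ball suffices for convergence because each coefficient of the
    iterates becomes stationary after finitely many steps: a bound on all iterates is a bound on the
    solution. *)

(** * The field of complex numbers and its modulus *)

Lemma Cx_ext (z w : Cx) : re z = re w -> im z = im w -> z = w.
Proof. destruct z, w; simpl; intros; subst; reflexivity. Qed.

Lemma Cx_neq0 (z : Cx) : z <> Czero -> re z * re z + im z * im z <> 0.
Proof.
  intros Hz H. apply Hz. apply Cx_ext; simpl; nra.
Qed.

Lemma Cx_field_theory :
  field_theory Czero Cone Cadd Cmul Csub Copp Cdiv Cinv (@eq Cx).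
Proof.
  constructor.
  - constructor; intros; apply Cx_ext; simpl; ring.
  - intros H. injection H. lra.
  - reflexivity.
  - intros z Hz. apply Cx_neq0 in Hz. apply Cx_ext; simpl; field; exact Hz.
Qed.

Add Field CxField : Cx_field_theory.

Lemma Cnorm_Cmod (z : Cx) : Cnorm z = Complex.Cmod (re z, im z).
Proof. unfold Cnorm, Complex.Cmod; simpl. f_equal. ring. Qed.

Lemma Cnorm_mul (z w : Cx) : Cnorm (Cmul z w) = Cnorm z * Cnorm w.
Proof. rewrite !Cnorm_Cmod, <- Complex.Cmod_mult. reflexivity. Qed.

Lemma Cnorm_add (z w : Cx) : Cnorm (Cadd z w) <= Cnorm z + Cnorm w.
Proof. rewrite !Cnorm_Cmod. exact (Complex.Cmod_triangle (re z, im z) (re w, im w)). Qed.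

Lemma Cnorm_opp (z : Cx) : Cnorm (Copp z) = Cnorm z.
Proof. unfold Cnorm; simpl. f_equal. ring. Qed.

Lemma Cnorm_ge0 (z : Cx) : 0 <= Cnorm z.
Proof. apply sqrt_pos. Qed.

Lemma Cnorm_0 : Cnorm Czero = 0.
Proof. unfold Cnorm; simpl. rewrite Rmult_0_l, Rplus_0_l. apply sqrt_0. Qed.

Lemma Cnorm_1 : Cnorm Cone = 1.
Proof.
  unfold Cnorm; simpl. replace (1 * 1 + 0 * 0) with 1 by ring. apply sqrt_1.
Qed.

Lemma Cnorm_sub (z w : Cx) : Cnorm (Csub z w) <= Cnorm z + Cnorm w.
Proof. unfold Csub. rewrite <- (Cnorm_opp w). apply Cnorm_add. Qed.

Lemma Cnorm_sub_sym (z w : Cx) : Cnorm (Csub z w) = Cnorm (Csub w z).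
Proof. rewrite <- Cnorm_opp. f_equal. ring. Qed.

Lemma Cnorm_eq0 (z : Cx) : Cnorm z = 0 -> z = Czero.
Proof.
  unfold Cnorm. intros H. apply sqrt_eq_0 in H; [|nra].
  apply Cx_ext; simpl; nra.
Qed.

Lemma Cnorm_gt0 (z : Cx) : z <> Czero -> 0 < Cnorm z.
Proof.
  intros Hz. destruct (Rle_lt_or_eq_dec _ _ (Cnorm_ge0 z)) as [H|H]; auto.
  exfalso; apply Hz, Cnorm_eq0; auto.
Qed.

Lemma Cnorm_inv (z : Cx) : z <> Czero -> Cnorm (Cinv z) = / Cnorm z.
Proof.
  intros Hz. pose proof (Cnorm_gt0 z Hz).
  apply Rmult_eq_reg_l with (Cnorm z); [|lra].
  rewrite <- Cnorm_mul, Rinv_r by lra.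
  replace (Cmul z (Cinv z)) with Cone by (field; exact Hz). apply Cnorm_1.
Qed.

Lemma Cnorm_pow (z : Cx) n : Cnorm (Cpow z n) = Cnorm z ^ n.
Proof. induction n; simpl; [apply Cnorm_1 | rewrite Cnorm_mul, IHn; ring]. Qed.

Lemma re_le_Cnorm (z : Cx) : Rabs (re z) <= Cnorm z.
Proof.
  rewrite <- sqrt_Rsqr_abs. apply sqrt_le_1_alt. unfold Rsqr. nra.
Qed.

Lemma im_le_Cnorm (z : Cx) : Rabs (im z) <= Cnorm z.
Proof.
  rewrite <- sqrt_Rsqr_abs. apply sqrt_le_1_alt. unfold Rsqr. nra.
Qed.

Lemma Cnorm_le_re_im (z : Cx) : Cnorm z <= Rabs (re z) + Rabs (im z).
Proof.
  replace z with (Cadd (mkC (re z) 0) (mkC 0 (im z))) at 1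
    by (apply Cx_ext; simpl; ring).
  eapply Rle_trans; [apply Cnorm_add|].
  unfold Cnorm; simpl.
  rewrite <- !sqrt_Rsqr_abs. unfold Rsqr.
  apply Req_le. f_equal; f_equal; ring.
Qed.

Lemma Cinv_neq0 (z : Cx) : z <> Czero -> Cinv z <> Czero.
Proof.
  intros Hz H. apply Cnorm_gt0 in Hz as Hp. apply Cnorm_inv in Hz.
  rewrite H, Cnorm_0 in Hz. apply Rinv_0_lt_compat in Hp. lra.
Qed.

Lemma Cmul_neq0 (z w : Cx) : z <> Czero -> w <> Czero -> Cmul z w <> Czero.
Proof.
  intros Hz Hw H. apply Cnorm_gt0 in Hz, Hw.
  assert (Cnorm (Cmul z w) = 0) by (rewrite H; apply Cnorm_0).
  rewrite Cnorm_mul in H0. nra.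
Qed.

Lemma Cpow_neq0 (z : Cx) n : z <> Czero -> Cpow z n <> Czero.
Proof.
  intros Hz. induction n; simpl; [exact (F_1_neq_0 Cx_field_theory) | auto using Cmul_neq0].
Qed.

Lemma Cpow_add (z : Cx) m n : Cpow z (m + n) = Cmul (Cpow z m) (Cpow z n).
Proof. induction m; simpl; [|rewrite IHm]; ring. Qed.

Lemma Cpow_mul (z w : Cx) n : Cpow (Cmul z w) n = Cmul (Cpow z n) (Cpow w n).
Proof. induction n; simpl; [|rewrite IHn]; ring. Qed.

Lemma Cpow_inv_l (z : Cx) n : z <> Czero -> Cmul (Cpow (Cinv z) n) (Cpow z n) = Cone.
Proof.
  intros Hz. rewrite <- Cpow_mul.
  replace (Cmul (Cinv z) z) with Cone by (field; exact Hz).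
  induction n; simpl; [|rewrite IHn]; ring.
Qed.

Lemma Cinv_mul (z w : Cx) :
  z <> Czero -> w <> Czero -> Cinv (Cmul z w) = Cmul (Cinv z) (Cinv w).
Proof. intros. field. auto. Qed.

(** * Formal power series *)

Section PowerSeries.

Variables (A : Type) (zero one : A) (add mul sub : A -> A -> A) (opp : A -> A).
Hypothesis A_ring : ring_theory zero one add mul sub opp (@eq A).

Add Ring Aring : A_ring.

Fixpoint psum (f : nat -> A) (n : nat) : A :=
  match n with O => f O | S k => add (psum f k) (f (S k)) end.

Definition conv (f g : nat -> A) : nat -> A :=
  fun n => psum (fun k => mul (f k) (g (n - k)%nat)) n.

Definition pconst (c : A) : nat -> A := fun n => match n with O => c | S _ => zero end.

Lemma psum_ext f g n :
  (forall k, (k <= n)%nat -> f k = g k) -> psum f n = psum g n.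
Proof.
  induction n; simpl; intros H; [apply H; lia|].
  rewrite IHn, H; auto.
Qed.

Lemma psum_add f g n : psum (fun k => add (f k) (g k)) n = add (psum f n) (psum g n).
Proof. induction n; simpl; [|rewrite IHn]; ring. Qed.

Lemma psum_mul_l c f n : psum (fun k => mul c (f k)) n = mul c (psum f n).
Proof. induction n; simpl; [|rewrite IHn]; ring. Qed.

Lemma psum_mul_r c f n : psum (fun k => mul (f k) c) n = mul (psum f n) c.
Proof. induction n; simpl; [|rewrite IHn]; ring. Qed.

Lemma psum_0 f n : (forall k, (k <= n)%nat -> f k = zero) -> psum f n = zero.
Proof.
  induction n; simpl; intros H; [apply H; lia|]. rewrite IHn, H; auto. ring.
Qed.

Lemma psum_Sl f n : psum f (S n) = add (f O) (psum (fun k => f (S k)) n).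
Proof.
  induction n; [reflexivity|].
  change (psum f (S (S n))) with (add (psum f (S n)) (f (S (S n)))).
  rewrite IHn. simpl. ring.
Qed.

Lemma psum_rev f n : psum f n = psum (fun k => f (n - k)%nat) n.
Proof.
  induction n; [reflexivity|].
  rewrite (psum_Sl (fun k => f (S n - k)%nat)). simpl. rewrite IHn.
  rewrite (psum_ext (fun k => f (n - k)%nat) (fun k => f (S n - S k)%nat)); [ring|auto].
Qed.

Lemma psum_triangle (F : nat -> nat -> A) n :
  psum (fun k => psum (fun i => F i (k - i)%nat) k) n =
  psum (fun i => psum (fun j => F i j) (n - i)) n.
Proof.
  induction n; [reflexivity|].
  cbn [psum]. rewrite IHn. rewrite !Nat.sub_diag. cbn [psum].
  rewrite (psum_ext (fun i => psum (fun j => F i j) (S n - i))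
            (fun i => add (psum (fun j => F i j) (n - i)) (F i (S n - i)%nat))).
  - rewrite psum_add. ring.
  - intros i Hi. rewrite Nat.sub_succ_l by auto. reflexivity.
Qed.

Lemma conv_comm f g : conv f g = conv g f.
Proof.
  extensionality n. unfold conv. rewrite psum_rev. apply psum_ext. intros k Hk.
  replace (n - (n - k))%nat with k by lia. ring.
Qed.

Lemma conv_assoc f g h : conv f (conv g h) = conv (conv f g) h.
Proof.
  extensionality n. unfold conv.
  rewrite (psum_ext (fun k => mul (f k) _)
     (fun i => psum (fun j => mul (f i) (mul (g j) (h (n - i - j)%nat))) (n - i)))
    by (intros; rewrite psum_mul_l; reflexivity).
  rewrite <- (psum_triangle (fun i j => mul (f i) (mul (g j) (h (n - i - j)%nat)))).
  apply psum_ext. intros k Hk. rewrite <- psum_mul_r. apply psum_ext. intros i Hi.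
  replace (n - i - (k - i))%nat with (n - k)%nat by lia. ring.
Qed.

Lemma conv_pconst c f : conv (pconst c) f = fun n => mul c (f n).
Proof.
  extensionality n. unfold conv. destruct n; [reflexivity|].
  rewrite psum_Sl. simpl. rewrite psum_0; [ring|]. intros; ring.
Qed.

Lemma powerseries_ring :
  ring_theory (fun _ => zero) (pconst one)
    (fun f g n => add (f n) (g n)) conv (fun f g n => sub (f n) (g n))
    (fun f n => opp (f n)) (@eq (nat -> A)).
Proof.
  constructor; intros; try (extensionality n; ring).
  - rewrite conv_pconst. extensionality n. ring.
  - apply conv_comm.
  - apply conv_assoc.
  - extensionality n. unfold conv. rewrite <- psum_add. apply psum_ext. intros; ring.
Qed.

End PowerSeries.

(** * The ring of double series in zeta1 and zeta2, and its dilations *)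

Definition fzero : FS := fun _ _ => Czero.
Definition fopp (f : FS) : FS := fun n m => Copp (f n m).

Lemma Csum_psum f n : Csum f n = psum Cx Cadd f n.
Proof. induction n; simpl; [|rewrite IHn]; reflexivity. Qed.

Lemma Csum_ext f g n :
  (forall k, (k <= n)%nat -> f k = g k) -> Csum f n = Csum g n.
Proof. rewrite !Csum_psum. apply psum_ext. Qed.

Lemma Csum_0 f n : (forall k, (k <= n)%nat -> f k = Czero) -> Csum f n = Czero.
Proof. rewrite Csum_psum. apply (psum_0 _ _ _ _ _ _ _ (F_R Cx_field_theory)). Qed.

Lemma Csum_mul_l c f n : Csum (fun k => Cmul c (f k)) n = Cmul c (Csum f n).
Proof. rewrite !Csum_psum. apply (psum_mul_l _ _ _ _ _ _ _ (F_R Cx_field_theory)). Qed.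

Lemma Csum_Sl f n : Csum f (S n) = Cadd (f O) (Csum (fun k => f (S k)) n).
Proof. rewrite !Csum_psum. apply (psum_Sl _ _ _ _ _ _ _ (F_R Cx_field_theory)). Qed.

Lemma psum_pointwise (F : nat -> nat -> Cx) n m :
  psum (nat -> Cx) (fun f g n => Cadd (f n) (g n)) F n m = Csum (fun k => F k m) n.
Proof. induction n; simpl; [|rewrite IHn]; reflexivity. Qed.

(** A double series is a power series in zeta1 whose coefficients are power series in zeta2, so the
    generic construction is applied twice; only the product and the unit have to be matched with
    [fmul] and [fconst Cone]. *)
Lemma FS_ring_theory :
  ring_theory fzero (fconst Cone) fadd fmul fsub fopp (@eq FS).
Proof.
  pose proof (powerseries_ring _ _ _ _ _ _ _
    (powerseries_ring _ _ _ _ _ _ _ (F_R Cx_field_theory))) as H.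
  match type of H with ring_theory ?z ?o ?a ?m ?s ?p _ =>
    assert (Em : m = fmul); [|assert (Eo : o = fconst Cone); [|rewrite Em, Eo in H; exact H]] end.
  - extensionality f. extensionality g. extensionality n. extensionality m.
    unfold conv at 1. rewrite psum_pointwise. unfold fmul.
    apply Csum_ext. intros k _. symmetry. apply Csum_psum.
  - extensionality n. extensionality m. destruct n, m; reflexivity.
Qed.

Add Ring FSRing : FS_ring_theory.

Definition Z1 : FS := fun n m => match n, m with 1%nat, O => Cone | _, _ => Czero end.
Definition Z2 : FS := fun n m => match n, m with O, 1%nat => Cone | _, _ => Czero end.

(** The substitution zeta1 -> al zeta1, zeta2 -> be zeta2. It is a ring endomorphism, and both
    shifts of the equation are instances of it. *)
Definition fdil (al be : Cx) (f : FS) : FS :=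
  fun n m => Cmul (Cmul (Cpow al n) (Cpow be m)) (f n m).

Lemma fmul_fconst c f : fmul (fconst c) f = fscale c f.
Proof.
  extensionality n. extensionality m. unfold fmul, fscale.
  assert (E : Csum (fun l => Cmul (fconst c O l) (f n (m - l)%nat)) m = Cmul c (f n m)).
  { destruct m; [reflexivity|]. rewrite Csum_Sl. simpl. rewrite Csum_0; [ring|].
    intros; ring. }
  destruct n.
  - exact E.
  - rewrite Csum_Sl. rewrite Nat.sub_0_r, E, Csum_0; [ring|].
    intros k _. apply Csum_0. intros. simpl. ring.
Qed.

Lemma fmul_Z1_O f m : fmul Z1 f O m = Czero.
Proof.
  apply Csum_0. intros k Hk. apply Csum_0. intros.
  replace k with O by lia. simpl. ring.
Qed.

Lemma fmul_Z1_S f n m : fmul Z1 f (S n) m = f n m.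
Proof.
  unfold fmul. rewrite Csum_Sl, Csum_0 by (intros; simpl; ring).
  assert (E : forall j, Csum (fun l => Cmul (Z1 1%nat l) (f j (m - l)%nat)) m = f j m).
  { intros j. destruct m; [simpl; ring|]. rewrite Csum_Sl. simpl.
    rewrite Csum_0; [ring|]. intros; ring. }
  destruct n.
  - cbn [Csum]. change (1 - 1)%nat with O. rewrite (E O). ring.
  - rewrite Csum_Sl. rewrite Nat.sub_succ, Nat.sub_0_r, E, Csum_0; [ring|].
    intros; apply Csum_0; intros; simpl; ring.
Qed.

Lemma ft_Z1_Z2 : ft = fmul Z1 Z2.
Proof.
  extensionality n. extensionality m. destruct n.
  - rewrite fmul_Z1_O. reflexivity.
  - rewrite fmul_Z1_S. destruct n, m as [|[|m]]; reflexivity.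
Qed.

Lemma fdil_mul al be f g : fdil al be (fmul f g) = fmul (fdil al be f) (fdil al be g).
Proof.
  extensionality n. extensionality m. unfold fdil, fmul.
  rewrite <- Csum_mul_l. apply Csum_ext. intros k Hk.
  rewrite <- Csum_mul_l. apply Csum_ext. intros l Hl.
  replace n with (k + (n - k))%nat at 1 by lia.
  replace m with (l + (m - l))%nat at 1 by lia.
  rewrite !Cpow_add. ring.
Qed.

Lemma fdil_sub al be f g : fdil al be (fsub f g) = fsub (fdil al be f) (fdil al be g).
Proof. extensionality n. extensionality m. unfold fdil, fsub. ring. Qed.

Lemma fdil_add al be f g : fdil al be (fadd f g) = fadd (fdil al be f) (fdil al be g).
Proof. extensionality n. extensionality m. unfold fdil, fadd. ring. Qed.

Lemma fdil_const al be c : fdil al be (fconst c) = fconst c.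
Proof.
  extensionality n. extensionality m. unfold fdil.
  destruct n, m; simpl; ring.
Qed.

Lemma fdil_Z1 al be : fdil al be Z1 = fmul (fconst al) Z1.
Proof.
  rewrite fmul_fconst. extensionality n. extensionality m. unfold fdil, fscale.
  destruct n as [|[|n]], m; simpl; ring.
Qed.

Lemma fdil_Z2 al be : fdil al be Z2 = fmul (fconst be) Z2.
Proof.
  rewrite fmul_fconst. extensionality n. extensionality m. unfold fdil, fscale.
  destruct n, m as [|[|m]]; simpl; ring.
Qed.

Lemma fhat_fdil Lam xi : fhat Lam xi = fdil (Cmul xi Lam) (Cinv Lam).
Proof.
  extensionality f. extensionality n. extensionality m.
  unfold fhat, fdil. rewrite Cpow_mul. ring.
Qed.

Lemma fcheck_fdil Lam xi :
  Lam <> Czero -> xi <> Czero -> fcheck Lam xi = fdil (Cinv (Cmul xi Lam)) Lam.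
Proof.
  intros HL Hx. extensionality f. extensionality n. extensionality m.
  unfold fcheck, fdil. rewrite Cinv_mul, Cpow_mul by auto. ring.
Qed.

Lemma fdil_inv al be f :
  al <> Czero -> be <> Czero -> fdil al be (fdil (Cinv al) (Cinv be) f) = f.
Proof.
  intros Ha Hb. extensionality n. extensionality m. unfold fdil.
  transitivity (Cmul (Cmul (Cmul (Cpow (Cinv al) n) (Cpow al n))
     (Cmul (Cpow (Cinv be) m) (Cpow be m))) (f n m)); [ring|].
  rewrite !Cpow_inv_l by auto. ring.
Qed.

Lemma fdil_inj al be f g :
  al <> Czero -> be <> Czero -> fdil al be f = fdil al be g -> f = g.
Proof.
  intros Ha Hb H. extensionality n. extensionality m.
  pose proof (f_equal (fun F => F n m) H) as E. unfold fdil in E. simpl in E.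
  assert (Hq : Cmul (Cpow al n) (Cpow be m) <> Czero) by auto using Cmul_neq0, Cpow_neq0.
  transitivity (Cmul (Cinv (Cmul (Cpow al n) (Cpow be m)))
    (Cmul (Cmul (Cpow al n) (Cpow be m)) (f n m))); [field|rewrite E; field];
    split; auto using Cpow_neq0.
Qed.

Lemma fconst_mul c d : fmul (fconst c) (fconst d) = fconst (Cmul c d).
Proof.
  rewrite fmul_fconst. extensionality n. extensionality m. unfold fscale.
  destruct n, m; simpl; ring.
Qed.

Lemma fconst_add c d : fadd (fconst c) (fconst d) = fconst (Cadd c d).
Proof.
  extensionality n. extensionality m. unfold fadd. destruct n, m; simpl; ring.
Qed.

(** * The reduced equation *)

(* [TP k] is the k-th parameter, [TV i] the i-fold shift of the unknown series. *)
Inductive term : Type :=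
| TOne : term
| TP : nat -> term
| TZ1 : term
| TZ2 : term
| TV : nat -> term
| TAdd : term -> term -> term
| TMul : term -> term -> term
| TOpp : term -> term.

Fixpoint shift (al be : Cx) (i : nat) (v : FS) : FS :=
  match i with O => v | S j => fdil al be (shift al be j v) end.

Fixpoint teval (e : nat -> Cx) (v : FS) (t : term) : FS :=
  match t with
  | TOne => fconst Cone
  | TP k => fconst (e k)
  | TZ1 => Z1
  | TZ2 => Z2
  | TV i => shift (e O) (e 1%nat) i v
  | TAdd t1 t2 => fadd (teval e v t1) (teval e v t2)
  | TMul t1 t2 => fmul (teval e v t1) (teval e v t2)
  | TOpp t1 => fopp (teval e v t1)
  end.

(* The variables [Z1], [Z2] count twice: in the convergence proof they are
   given a size quadratic in the size of the unknown series. *)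
Fixpoint ord (t : term) : nat :=
  match t with
  | TOne | TP _ => 0
  | TZ1 | TZ2 => 2
  | TV _ => 1
  | TAdd t1 t2 => Nat.min (ord t1) (ord t2)
  | TMul t1 t2 => ord t1 + ord t2
  | TOpp t1 => ord t1
  end.

Declare Scope term_scope.
Delimit Scope term_scope with T.
Bind Scope term_scope with term.
Notation "x + y" := (TAdd x y) : term_scope.
Notation "x * y" := (TMul x y) : term_scope.
Notation "- x" := (TOpp x) : term_scope.
Notation "x - y" := (TAdd x (TOpp y)) : term_scope.

(* Parameters: 0 = q1, 1 = q2, 2 = 1/q1, 3 = xi, 4 = 1/xi,
   5, 6, 7, 8 = z + 1/z for z = a, b, c, d. *)
Definition remainder : term :=
  (let q1 := TP 0 in let q1i := TP 2 in let xi := TP 3 in let xii := TP 4 in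
   let z1 := q1 * TZ1 in let z2 := TP 1 * TZ2 in
   let V0 := TV 0 in let V1 := TV 1 in let V2 := TV 2 in
   let U0 := TOne + V0 in let U1 := TOne + V1 in let U2 := TOne + V2 in
   let lin := V0 + V2 - (V1 + V1) in
   let x1 := z1 * U1 in
   let p := (x1 - TP 7) + (x1 - TP 8) + x1 * (x1 - TP 7) * (x1 - TP 8) in
   let w := z2 * (z2 * z2 - xi * q1i * U1 * U0 - xii * q1 * U1 * U2) in
   let y := z1 * (z1 * z1 * U1 * U1 * U0 * U2 - q1 * U1 * U2 - q1i * U1 * U0) in
   let ra := z2 - TP 5 * U1 in let rb := z2 - TP 6 * U1 in
   let r := U1 * U1 * (ra + rb) + z2 * ra * rb in
   (V1 + V1 + V1 * V1) * lin + U1 * U1 * (V0 * V2 - V1 * V1)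
   + z1 * (U1 * p * (U1 * U1 * U0 * U2 + z2 * w) - y * (U1 * U1 * U1 * U1 + z2 * r))
   + z2 * (w - r))%T.

Definition linear_part : term := (TV 0 + TV 2 - (TV 1 + TV 1))%T.

Definition params (Lam xi a b c d : Cx) (k : nat) : Cx :=
  match k with
  | 0 => Cmul xi Lam
  | 1 => Cinv Lam
  | 2 => Cinv (Cmul xi Lam)
  | 3 => xi
  | 4 => Cinv xi
  | 5 => Cadd a (Cinv a)
  | 6 => Cadd b (Cinv b)
  | 7 => Cadd c (Cinv c)
  | 8 => Cadd d (Cinv d)
  | _ => Czero
  end%nat.

Lemma fconst_mulV z : z <> Czero -> fmul (fconst z) (fconst (Cinv z)) = fconst Cone.
Proof. intros. rewrite fconst_mul. f_equal. field. auto. Qed.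

(** Pairing the factors of z and 1/z leaves z + 1/z as the only trace of the parameter, which is why
    [params] stores these sums. *)
Lemma quadratic_factor z x t :
  z <> Czero ->
  fmul (fsub x (fmul (fconst z) t)) (fsub x (fmul (fconst (Cinv z)) t)) =
  fadd (fsub (fmul x x) (fmul (fmul (fconst (Cadd z (Cinv z))) t) x)) (fmul t t).
Proof.
  intros Hz. rewrite <- fconst_add. pose proof (fconst_mulV z Hz) as H.
  ring [H].
Qed.

(** The forward-shifted equation as an identity in a commutative ring where only q1 q1i = 1 and xi
    xii = 1 are known. On the left z1^2 divides each of the two factors built from x1 x2 and x1 x0;
    on the right it divides each of the two quadratic factors. Together they give z1^4 on both
    sides. The terms [p], [w], [y], [r] collect what the factors contribute beyond their lowest
    part. *)
Lemma reduction_identity (z1 z2 V0 V1 V2 q1 q1i xi xii A B C D : FS) :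
  fmul q1 q1i = fconst Cone -> fmul xi xii = fconst Cone ->
  let U0 := fadd (fconst Cone) V0 in
  let U1 := fadd (fconst Cone) V1 in
  let U2 := fadd (fconst Cone) V2 in
  let x1 := fmul z1 U1 in
  let x0 := fmul (fmul q1i z1) U0 in
  let x2 := fmul (fmul q1 z1) U2 in
  let t := fmul z1 z2 in
  let lin := fadd (fadd V0 V2) (fopp (fadd V1 V1)) in
  let p := fadd (fadd (fsub x1 C) (fsub x1 D)) (fmul (fmul x1 (fsub x1 C)) (fsub x1 D)) in
  let w := fmul z2 (fsub (fsub (fmul z2 z2) (fmul (fmul (fmul xi q1i) U1) U0))
                         (fmul (fmul (fmul xii q1) U1) U2)) in
  let y := fmul z1 (fsub (fsub (fmul (fmul (fmul (fmul (fmul z1 z1) U1) U1) U0) U2)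
                               (fmul (fmul q1 U1) U2)) (fmul (fmul q1i U1) U0)) in
  let ra := fsub z2 (fmul A U1) in
  let rb := fsub z2 (fmul B U1) in
  let r := fadd (fmul (fmul U1 U1) (fadd ra rb)) (fmul (fmul z2 ra) rb) in
  let H := fadd (fadd (fadd
      (fmul (fadd (fadd V1 V1) (fmul V1 V1)) lin)
      (fmul (fmul U1 U1) (fsub (fmul V0 V2) (fmul V1 V1))))
      (fmul z1 (fsub
        (fmul (fmul U1 p) (fadd (fmul (fmul (fmul U1 U1) U0) U2) (fmul z2 w)))
        (fmul y (fadd (fmul (fmul (fmul U1 U1) U1) U1) (fmul z2 r))))))
      (fmul z2 (fsub w r)) in
  fsub
   (fmul (fmul (fmul (fsub (fmul x1 x2) (fmul xi (fmul t t)))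
                     (fsub (fmul x1 x0) (fmul xii (fmul t t))))
     (fadd (fsub (fmul x1 x1) (fmul C x1)) (fconst Cone)))
     (fadd (fsub (fmul x1 x1) (fmul D x1)) (fconst Cone)))
   (fmul (fmul (fmul (fsub (fmul x1 x2) (fconst Cone)) (fsub (fmul x1 x0) (fconst Cone)))
     (fadd (fsub (fmul x1 x1) (fmul (fmul A t) x1)) (fmul t t)))
     (fadd (fsub (fmul x1 x1) (fmul (fmul B t) x1)) (fmul t t)))
  = fmul z1 (fmul z1 (fmul z1 (fmul z1 (fadd lin H)))).
Proof.
  intros Hq Hx U0 U1 U2 x1 x0 x2 t lin p w y ra rb r H.
  (* With U = 1 + V, U0 U2 - U1^2 = lin + (V0 V2 - V1^2) and U1^2 = 1 + (2 V1 + V1^2): [lin] and the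
     first two summands of [H] reassemble to U1^2 (U0 U2 - U1^2). Generalizing first over [p w y r]
     and later over [U0 U1 U2] keeps the polynomials given to [ring] small. *)
  assert (E : fadd lin H = fadd (fadd (fmul (fmul U1 U1) (fsub (fmul U0 U2) (fmul U1 U1)))
      (fmul z1 (fsub
        (fmul (fmul U1 p) (fadd (fmul (fmul (fmul U1 U1) U0) U2) (fmul z2 w)))
        (fmul y (fadd (fmul (fmul (fmul U1 U1) U1) U1) (fmul z2 r))))))
      (fmul z2 (fsub w r))).
  { unfold H. generalize p w y r. intros. unfold lin, U0, U1, U2. ring. }
  rewrite E. clear E H. clear lin.
  unfold p, w, y, r, ra, rb, x0, x1, x2, t.
  generalize U0 U1 U2. clear - Hq Hx. intros. ring [Hq Hx].
Qed.

Lemma quadratic_factor_const z x :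
  z <> Czero ->
  fmul (fsub x (fconst z)) (fsub x (fconst (Cinv z))) =
  fadd (fsub (fmul x x) (fmul (fconst (Cadd z (Cinv z))) x)) (fconst Cone).
Proof.
  intros Hz. rewrite <- fconst_add. pose proof (fconst_mulV z Hz) as H.
  ring [H].
Qed.

Lemma fmul_regroup w p1 p2 p3 p4 :
  fmul (fmul (fmul (fmul w p1) p2) p3) p4 = fmul (fmul w (fmul p1 p2)) (fmul p3 p4).
Proof. ring. Qed.

Lemma fsub_eq0 f g : f = g <-> fsub f g = fzero.
Proof.
  split; intros H; [rewrite H; ring|].
  transitivity (fadd (fsub f g) g); [ring | rewrite H; ring].
Qed.

Lemma fmul_Z1_eq0 q f : q <> Czero -> fmul (fmul (fconst q) Z1) f = fzero -> f = fzero.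
Proof.
  intros Hq H. extensionality n. extensionality m.
  apply (f_equal (fun F => fmul (fconst (Cinv q)) F (S n) m)) in H.
  replace (fmul (fconst (Cinv q)) (fmul (fmul (fconst q) Z1) f)) with (fmul Z1 f) in H.
  - rewrite fmul_Z1_S in H. rewrite H.
    replace (fmul (fconst (Cinv q)) fzero) with fzero by ring. reflexivity.
  - pose proof (fconst_mulV q Hq) as E. ring [E].
Qed.

Section Reduction.

Variables (Lam xi a b c d : Cx).
Hypotheses (HL : Lam <> Czero) (Hxi : xi <> Czero) (Ha : a <> Czero) (Hb : b <> Czero)
  (Hc : c <> Czero) (Hd : d <> Czero).

Let e := params Lam xi a b c d.
Let q1 := Cmul xi Lam.
Let q2 := Cinv Lam.

Let Hq1 : q1 <> Czero.
Proof. apply Cmul_neq0; auto. Qed.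
Let Hq2 : q2 <> Czero.
Proof. apply Cinv_neq0; auto. Qed.

Lemma shifted_x v :
  fdil q1 q2 (fmul Z1 (fadd (fconst Cone) v)) =
  fmul (fmul (fconst q1) Z1) (fadd (fconst Cone) (fdil q1 q2 v)).
Proof. rewrite fdil_mul, fdil_add, fdil_Z1, fdil_const. reflexivity. Qed.

(** The dilation by q1, q2 is injective because both are nonzero, so the equation may be tested
    after it; it sends the backward shift of x to x itself, and the remaining occurrences of x to
    forward dilations. The factor (q1 zeta1)^4 is then cancelled, since multiplication by zeta1
    merely moves indices. *)
Lemma qPA1_formal_reduced v :
  qPA1_formal Lam xi a b c d (fmul Z1 (fadd (fconst Cone) v)) <->
  fadd (teval e v linear_part) (teval e v remainder) = fzero.
Proof.
  set (x := fmul Z1 (fadd (fconst Cone) v)).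
  pose (s := fdil q1 q2).
  assert (Exh : fhat Lam xi x = s x) by (rewrite fhat_fdil; reflexivity).
  assert (Exc : s (fcheck Lam xi x) = x).
  { rewrite fcheck_fdil by auto. 
    replace (fdil (Cinv (Cmul xi Lam)) Lam x) with (fdil (Cinv q1) (Cinv q2) x).
    - apply fdil_inv; auto.
    - f_equal. unfold q2. field. split; [auto | exact (F_1_neq_0 Cx_field_theory)]. }
  unfold qPA1_formal. cbv zeta. rewrite Exh.
  match goal with |- (forall n m, ?l n m = ?r n m) <-> _ =>
    assert (E1 : (forall n m, l n m = r n m) <-> s l = s r) end.
  { split.
    - intros H. f_equal. extensionality n. extensionality m. apply H.
    - intros H n m. apply fdil_inj in H; auto. rewrite H. reflexivity. }
  rewrite E1. clear E1.
  unfold s. rewrite <- !fmul_fconst.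
  repeat rewrite ?fdil_mul, ?fdil_sub, ?fdil_const, ?ft_Z1_Z2, ?fdil_Z1, ?fdil_Z2.
  change (fdil q1 q2 (fcheck Lam xi x)) with (s (fcheck Lam xi x)). rewrite Exc.
  unfold x. rewrite !shifted_x, !fdil_mul, !fdil_add, !fdil_const, !fdil_Z1.
  pose proof (fconst_mulV q1 Hq1) as Eq1.
  pose proof (fconst_mulV xi Hxi) as Exi.
  (* The undilated x is also written as a multiple of q1 zeta1, the quantity that plays z1 in
     [reduction_identity]. *)
  replace (fmul Z1 (fadd (fconst Cone) v)) with
    (fmul (fmul (fconst (Cinv q1)) (fmul (fconst q1) Z1)) (fadd (fconst Cone) v))
    by ring [Eq1].
  rewrite !fmul_regroup, !quadratic_factor, !quadratic_factor_const by auto.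
  pose proof (reduction_identity (fmul (fconst q1) Z1) (fmul (fconst q2) Z2)
    v (fdil q1 q2 v) (fdil q1 q2 (fdil q1 q2 v)) (fconst q1) (fconst (Cinv q1))
    (fconst xi) (fconst (Cinv xi)) (fconst (Cadd a (Cinv a))) (fconst (Cadd b (Cinv b)))
    (fconst (Cadd c (Cinv c))) (fconst (Cadd d (Cinv d))) Eq1 Exi) as E.
  cbv zeta in E. rewrite fsub_eq0, E.
  change (fadd (teval e v linear_part) (teval e v remainder)) with
   (let V0 := v in let V1 := fdil q1 q2 v in let V2 := fdil q1 q2 (fdil q1 q2 v) in
    fadd (fadd (fadd V0 V2) (fopp (fadd V1 V1))) (teval e v remainder)).
  cbv zeta.
  match goal with |- fmul _ (fmul _ (fmul _ (fmul _ ?g))) = _ <-> ?h = _ =>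
    change h with g; generalize g end.
  intros g. split; intros Hg.
  - do 4 apply (fmul_Z1_eq0 q1 _ Hq1) in Hg. exact Hg.
  - rewrite Hg. ring.
Qed.

Lemma linear_part_coef v n m :
  let Q := Cmul (Cpow q1 n) (Cpow q2 m) in
  teval e v linear_part n m = Cmul (Cmul (Csub Cone Q) (Csub Cone Q)) (v n m).
Proof.
  intros Q. cbn [teval linear_part shift]. unfold fadd, fopp, fdil.
  change (e O) with q1. change (e 1%nat) with q2. unfold Q. ring.
Qed.

End Reduction.

Lemma is_xseries_decomp (x : FS) :
  is_xseries x -> exists v, x = fmul Z1 (fadd (fconst Cone) v) /\
    (forall n m, x (S n) m = Cadd (fconst Cone n m) (v n m)).
Proof.
  intros Hx. pose (v := fun n m => Csub (x (S n) m) (fconst Cone n m)).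
  exists v.
  assert (E : forall n m, x (S n) m = fadd (fconst Cone) v n m).
  { intros. unfold fadd, v. ring. }
  split; [|exact E]. extensionality n. extensionality m. destruct n.
  - rewrite fmul_Z1_O. apply Hx.
  - rewrite fmul_Z1_S. apply E.
Qed.

(** * Existence and uniqueness *)

Lemma fmul_ext_at f f' g g' n m :
  (forall k l, (k <= n)%nat -> (l <= m)%nat ->
     Cmul (f k l) (g (n - k)%nat (m - l)%nat) = Cmul (f' k l) (g' (n - k)%nat (m - l)%nat)) ->
  fmul f g n m = fmul f' g' n m.
Proof. intros H. apply Csum_ext. intros. apply Csum_ext. intros. auto. Qed.

Lemma shift_local al be i v v' n m :
  v n m = v' n m -> shift al be i v n m = shift al be i v' n m.
Proof. intros H. induction i; simpl; auto. unfold fdil. rewrite IHi. reflexivity. Qed.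

Lemma teval_local e t v v' n m :
  (forall k l, (k <= n)%nat -> (l <= m)%nat -> v k l = v' k l) ->
  teval e v t n m = teval e v' t n m.
Proof.
  revert n m. induction t as [|p| | |i|t1 IHt1 t2 IHt2|t1 IHt1 t2 IHt2|t IHt]; simpl; intros n m H; auto.
  - apply shift_local; auto.
  - unfold fadd. rewrite IHt1, IHt2; auto.
  - apply fmul_ext_at. intros k l Hk Hl. f_equal; [apply IHt1 | apply IHt2];
      intros; apply H; lia.
  - unfold fopp. rewrite IHt; auto.
Qed.

Lemma teval_00 e t v : v O O = Czero -> (1 <= ord t)%nat -> teval e v t O O = Czero.
Proof.
  intros Hv. induction t as [|p| | |i|t1 IHt1 t2 IHt2|t1 IHt1 t2 IHt2|t IHt]; simpl; intros Ho; try lia; try reflexivity.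
  - rewrite (shift_local _ _ _ v fzero) by exact Hv.
    clear. induction i; simpl; [reflexivity|]. unfold fdil. rewrite IHi. ring.
  - unfold fadd. rewrite IHt1, IHt2 by lia. ring.
  - unfold fmul. simpl.
    destruct (ord t1); [rewrite IHt2 by lia | rewrite IHt1 by lia]; ring.
  - unfold fopp. rewrite IHt by auto. ring.
Qed.

(** In a product, the top coefficient (n,m) of one factor only meets the constant coefficient of the
    other. If that other factor has positive order, its constant coefficient vanishes; if it has
    order 0, the first one has order at least 2 and the induction hypothesis applies. Hence the
    remainder at (n,m) never reads the coefficient that it is used to determine. *)
Lemma teval_strict e t v v' n m :
  v O O = Czero -> v' O O = Czero -> (2 <= ord t)%nat ->
  (forall k l, (k <= n)%nat -> (l <= m)%nat -> (k, l) <> (n, m) -> v k l = v' k l) ->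
  teval e v t n m = teval e v' t n m.
Proof.
  intros Hv Hv' Ho H.
  destruct (Nat.eq_dec (n + m) 0) as [E0|E0].
  { replace n with O by lia. replace m with O by lia.
    rewrite !teval_00; auto; lia. }
  assert (Hloc : forall t k l, (k <= n)%nat -> (l <= m)%nat -> (k, l) <> (n, m) ->
            teval e v t k l = teval e v' t k l).
  { intros t0 k l Hk Hl Hkl. apply teval_local. intros. apply H; try lia.
    intros Eq. apply Hkl. injection Eq. intros. f_equal; lia. }
  induction t as [|p| | |i|t1 IHt1 t2 IHt2|t1 IHt1 t2 IHt2|t IHt]; simpl in *; try lia; auto.
  - unfold fadd. rewrite IHt1, IHt2 by lia. reflexivity.
  - apply fmul_ext_at. intros k l Hk Hl.
    (* Constant coefficient of [t1] against the top coefficient of [t2]. *)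
    destruct (Nat.eq_dec (k + l) 0) as [E|E].
    { replace k with O by lia. replace l with O by lia. rewrite !Nat.sub_0_r.
      rewrite (Hloc t1 O O) by (try lia; intros Q; injection Q; lia).
      destruct (ord t1) eqn:O1.
      - rewrite IHt2 by lia. reflexivity.
      - rewrite teval_00 by (auto; lia). ring. }
    rewrite (Hloc t2 (n - k) (m - l))%nat by (try lia; intros Q; injection Q; lia).
    destruct (Nat.eq_dec k n) as [E1|E1]; [destruct (Nat.eq_dec l m) as [E2|E2]|].
    (* The symmetric case: top coefficient of [t1] against the constant coefficient of [t2]. *)
    + subst k l. rewrite !Nat.sub_diag. destruct (ord t2) eqn:O2.
      * rewrite IHt1 by lia. reflexivity.
      * rewrite (teval_00 _ t2) by (auto; lia). ring.
    + rewrite (Hloc t1 k l) by (try lia; intros Q; injection Q; lia). reflexivity.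
    + rewrite (Hloc t1 k l) by (try lia; intros Q; injection Q; lia). reflexivity.
  - unfold fopp. rewrite IHt by auto. reflexivity.
Qed.

Definition multiplier (e : nat -> Cx) (n m : nat) : Cx :=
  Cmul (Cpow (e O) n) (Cpow (e 1%nat) m).

(** The linear part is inverted on the remainder. At (0,0) the multiplier 1 - Q is zero; the value
    prescribed there is the normalization x_{1,1} = 1 expressed in v. *)
Definition Phi (e : nat -> Cx) (v : FS) : FS :=
  fun n m => match n, m with
  | O, O => Czero
  | _, _ => Copp (Cmul (Cmul (Cinv (Csub Cone (multiplier e n m)))
                             (Cinv (Csub Cone (multiplier e n m))))
                       (teval e v remainder n m))
  end.

Fixpoint approx (e : nat -> Cx) (k : nat) : FS :=
  match k with O => fzero | S j => Phi e (approx e j) end.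

(** The coefficientwise limit of the iterates: iterate number n + m + 1 is one in which coefficient
    (n,m) has already become final. *)
Definition vsol (e : nat -> Cx) : FS := fun n m => approx e (S (n + m)) n m.

Definition xsol (e : nat -> Cx) : FS := fmul Z1 (fadd (fconst Cone) (vsol e)).

Lemma approx_00 e k : approx e k O O = Czero.
Proof. destruct k; reflexivity. Qed.

Lemma ord_remainder : (2 <= ord remainder)%nat.
Proof. vm_compute. lia. Qed.

Lemma Phi_strict e v v' n m :
  v O O = Czero -> v' O O = Czero ->
  (forall k l, (k <= n)%nat -> (l <= m)%nat -> (k, l) <> (n, m) -> v k l = v' k l) ->
  Phi e v n m = Phi e v' n m.
Proof.
  intros Hv Hv' H. unfold Phi.
  rewrite (teval_strict e remainder v v' n m Hv Hv' ord_remainder H). reflexivity.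
Qed.

(** Since [Phi] at (n,m) reads only coefficients of smaller total degree, each iteration settles one
    more total degree. *)
Lemma approx_stable e k : forall j n m,
  (n + m < k)%nat -> (k <= j)%nat -> approx e j n m = approx e k n m.
Proof.
  induction k; intros j n m Hk Hj; [lia|]. destruct j; [lia|].
  simpl. apply Phi_strict; auto using approx_00.
  intros k' l Hk' Hl Hne. apply IHk; [|lia].
  destruct (Nat.eq_dec k' n), (Nat.eq_dec l m); try lia. subst. congruence.
Qed.

Lemma vsol_approx e k n m : (n + m < k)%nat -> approx e k n m = vsol e n m.
Proof. intros. apply approx_stable; lia. Qed.

Lemma vsol_00 e : vsol e O O = Czero.
Proof. reflexivity. Qed.

Lemma vsol_fix e : Phi e (vsol e) = vsol e.
Proof.
  extensionality n. extensionality m.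
  rewrite <- (vsol_approx e (S (S (n + m))) n m) by lia.
  change (approx e (S (S (n + m)))) with (Phi e (approx e (S (n + m)))).
  apply Phi_strict; auto using approx_00, vsol_00.
  intros. symmetry. apply vsol_approx. lia.
Qed.

Lemma Phi_fix_unique e v : Phi e v = v -> v = vsol e.
Proof.
  intros Hv. assert (V0 : v O O = Czero) by (rewrite <- Hv; reflexivity).
  assert (H : forall N n m, (n + m < N)%nat -> v n m = vsol e n m).
  { induction N; intros n m HN; [lia|]. rewrite <- Hv, <- vsol_fix.
    apply Phi_strict; auto using vsol_00. intros k l Hk Hl Hne. apply IHN.
    destruct (Nat.eq_dec k n), (Nat.eq_dec l m); try lia. subst. congruence. }
  extensionality n. extensionality m. apply (H (S (n + m))). lia.
Qed.

Section Solution.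

Variables (Lam xi a b c d : Cx).
Hypothesis HD : Dom Lam xi a b c d.

Let e := params Lam xi a b c d.

Lemma one_sub_multiplier_neq0 n m :
  (n, m) <> (O, O) -> Csub Cone (multiplier e n m) <> Czero.
Proof.
  destruct HD as (_ & _ & _ & _ & _ & _ & Hr). intros Hnm H. apply (Hr n m Hnm).
  change (multiplier e n m = Cone).
  transitivity (Csub Cone (Csub Cone (multiplier e n m))); [ring | rewrite H; ring].
Qed.

(** Away from (0,0) the square of 1 - Q is invertible by nonresonance, and the two equations differ
    by this factor. At (0,0), once v has no constant coefficient, the reduced equation reads 0 = 0
    because both of its parts have positive order, in agreement with the convention in [Phi]. *)
Lemma qPA1_iff_Phi_fix v :
  v O O = Czero ->
  qPA1_formal Lam xi a b c d (fmul Z1 (fadd (fconst Cone) v)) <-> Phi e v = v.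
Proof.
  intros V0. destruct HD as (HL & Hx & Ha & Hb & Hc & Hd & _).
  rewrite qPA1_formal_reduced by auto.
  assert (K : forall n m, (n, m) <> (O, O) ->
    (fadd (teval e v linear_part) (teval e v remainder) n m = Czero <->
     Copp (Cmul (Cmul (Cinv (Csub Cone (multiplier e n m)))
                             (Cinv (Csub Cone (multiplier e n m))))
                       (teval e v remainder n m)) = v n m)).
  { intros n m Hnm. pose proof (one_sub_multiplier_neq0 n m Hnm) as Hq.
    unfold fadd. unfold e at 1. rewrite linear_part_coef. cbv zeta.
    change (Cmul (Cpow (Cmul xi Lam) n) (Cpow (Cinv Lam) m)) with (multiplier e n m).
    revert Hq. generalize (Csub Cone (multiplier e n m)) (teval e v remainder n m) (v n m).
    clear. intros q h w Hq. split; intros E.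
    - replace h with (Csub (Cadd (Cmul (Cmul q q) w) h) (Cmul (Cmul q q) w)) by ring.
      rewrite E. field. exact Hq.
    - rewrite <- E. field. exact Hq. }
  split; intros H.
  - extensionality n. extensionality m.
    pose proof (f_equal (fun F => F n m) H) as E.
    destruct n, m; [symmetry; exact V0| | |]; (apply K; [discriminate | exact E]).
  - extensionality n. extensionality m.
    pose proof (f_equal (fun F => F n m) H) as E.
    destruct n, m; [| | |]; try (apply K; [discriminate | exact E]).
    unfold fadd. rewrite !teval_00; [apply (Radd_0_l (F_R Cx_field_theory)) | | | |];
      auto using ord_remainder; try (vm_compute; lia).
Qed.

Lemma xsol_solution : qPA1_formal Lam xi a b c d (xsol e).
Proof. apply qPA1_iff_Phi_fix; [reflexivity | apply vsol_fix]. Qed.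

Lemma xsol_unique y :
  is_xseries y -> y 1%nat O = Cone -> qPA1_formal Lam xi a b c d y -> y = xsol e.
Proof.
  intros Hy Hy1 H. destruct (is_xseries_decomp y Hy) as (v & -> & Hv).
  unfold xsol. do 2 f_equal.
  assert (V0 : v O O = Czero).
  { transitivity (Csub (Cadd (fconst Cone O O) (v O O)) Cone); [simpl; ring|].
    rewrite <- Hv, Hy1. ring. }
  apply Phi_fix_unique, qPA1_iff_Phi_fix; auto.
Qed.

End Solution.

Lemma xsol_is_xseries e : is_xseries (xsol e).
Proof. intros m. apply fmul_Z1_O. Qed.

Lemma xsol_10 e : xsol e 1%nat O = Cone.
Proof. unfold xsol. rewrite fmul_Z1_S. unfold fadd. rewrite vsol_00. simpl. ring. Qed.

(** * Rationality of the coefficients *)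

Definition RR := rational_regular_on Dom.

Lemma RR_const z : RR (fun _ _ _ _ _ _ => z).
Proof.
  exists (PC z), (PC Cone). intros. simpl. split.
  - exact (F_1_neq_0 Cx_field_theory).
  - field. exact (F_1_neq_0 Cx_field_theory).
Qed.

Lemma RR_var k : RR (fun Lam xi a b c d => env6 Lam xi a b c d k).
Proof.
  exists (PV k), (PC Cone). intros. simpl. split.
  - exact (F_1_neq_0 Cx_field_theory).
  - field. exact (F_1_neq_0 Cx_field_theory).
Qed.

Lemma RR_add F G : RR F -> RR G ->
  RR (fun Lam xi a b c d => Cadd (F Lam xi a b c d) (G Lam xi a b c d)).
Proof.
  intros (P & Q & H) (P' & Q' & H').
  exists (PAdd (PMul P Q') (PMul P' Q)), (PMul Q Q'). intros * HD.
  destruct (H _ _ _ _ _ _ HD) as [H1 ->], (H' _ _ _ _ _ _ HD) as [H1' ->]. simpl.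
  split; [auto using Cmul_neq0 | field; auto].
Qed.

Lemma RR_mul F G : RR F -> RR G ->
  RR (fun Lam xi a b c d => Cmul (F Lam xi a b c d) (G Lam xi a b c d)).
Proof.
  intros (P & Q & H) (P' & Q' & H').
  exists (PMul P P'), (PMul Q Q'). intros * HD.
  destruct (H _ _ _ _ _ _ HD) as [H1 ->], (H' _ _ _ _ _ _ HD) as [H1' ->]. simpl.
  split; [auto using Cmul_neq0 | field; auto].
Qed.

Lemma RR_opp F : RR F -> RR (fun Lam xi a b c d => Copp (F Lam xi a b c d)).
Proof.
  intros (P & Q & H). exists (POpp P), Q. intros * HD.
  destruct (H _ _ _ _ _ _ HD) as [H1 ->]. simpl. split; [auto | field; auto].
Qed.

Lemma RR_inv F : RR F ->
  (forall Lam xi a b c d, Dom Lam xi a b c d -> F Lam xi a b c d <> Czero) ->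
  RR (fun Lam xi a b c d => Cinv (F Lam xi a b c d)).
Proof.
  intros (P & Q & H) HF. exists Q, P. intros * HD. specialize (HF _ _ _ _ _ _ HD).
  destruct (H _ _ _ _ _ _ HD) as [H1 E]. rewrite E in *.
  assert (HP : peval (env6 Lam xi a b c d) P <> Czero).
  { intros HP. apply HF. rewrite HP. unfold Cdiv. ring. }
  split; [auto | field; auto].
Qed.

Lemma RR_pow F n : RR F -> RR (fun Lam xi a b c d => Cpow (F Lam xi a b c d) n).
Proof. intros H. induction n; simpl; [apply RR_const | apply RR_mul; auto]. Qed.

Lemma RR_sum (F : nat -> Cx -> Cx -> Cx -> Cx -> Cx -> Cx -> Cx) n :
  (forall k, RR (F k)) ->
  RR (fun Lam xi a b c d => Csum (fun k => F k Lam xi a b c d) n).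
Proof. intros H. induction n; simpl; [apply H | apply RR_add; auto]. Qed.

Lemma RR_params k : RR (fun Lam xi a b c d => params Lam xi a b c d k).
Proof.
  assert (V : forall j (G := fun Lam xi a b c d => env6 Lam xi a b c d j),
     RR G /\ RR (fun Lam xi a b c d => Cinv (G Lam xi a b c d))).
  { intros j G. split; [apply RR_var|]. apply RR_inv; [apply RR_var|].
    unfold G. intros * (? & ? & ? & ? & ? & ? & _).
    destruct j as [|[|[|[|[|j]]]]]; assumption. }
  destruct k as [|[|[|[|[|[|[|[|[|k]]]]]]]]]; simpl; [| | | | | | | | |apply RR_const].
  - apply RR_mul; [apply (V 1%nat) | apply (V 0%nat)].
  - apply (V 0%nat).
  - apply RR_inv; [apply RR_mul; [apply (V 1%nat) | apply (V 0%nat)]|].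
    intros * (? & ? & _). apply Cmul_neq0; auto.
  - apply (V 1%nat).
  - apply (V 1%nat).
  - apply RR_add; apply (V 2%nat).
  - apply RR_add; apply (V 3%nat).
  - apply RR_add; apply (V 4%nat).
  - apply RR_add; apply (V 5%nat).
Qed.

Lemma RR_multiplier n m :
  RR (fun Lam xi a b c d => multiplier (params Lam xi a b c d) n m).
Proof. apply RR_mul; apply RR_pow; apply RR_params. Qed.

Lemma RR_teval t (v : Cx -> Cx -> Cx -> Cx -> Cx -> Cx -> FS) :
  (forall n m, RR (fun Lam xi a b c d => v Lam xi a b c d n m)) ->
  forall n m,
    RR (fun Lam xi a b c d => teval (params Lam xi a b c d) (v Lam xi a b c d) t n m).
Proof.
  intros Hv. induction t as [|p| | |i|t1 IHt1 t2 IHt2|t1 IHt1 t2 IHt2|t IHt]; simpl; intros N M.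
  - apply RR_const.
  - destruct N, M; [apply RR_params | apply (RR_const Czero) ..].
  - apply RR_const.
  - apply RR_const.
  - induction i; simpl; [apply Hv|].
    apply RR_mul; [|exact IHi]. exact (RR_multiplier N M).
  - apply RR_add; auto.
  - apply (RR_sum (fun k Lam xi a b c d => Csum (fun l => _) M)). intros k.
    apply (RR_sum (fun l Lam xi a b c d => Cmul _ _)). intros l.
    apply RR_mul; [apply IHt1 | apply IHt2].
  - apply RR_opp; auto.
Qed.

(** Each coefficient of an iterate arises by finitely many ring operations from the parameters and
    the inverses of 1 - q1^n q2^m, whose denominators do not vanish on [Dom]. *)
Lemma RR_approx k : forall n m,
  RR (fun Lam xi a b c d => approx (params Lam xi a b c d) k n m).
Proof.
  induction k; intros n m; [apply (RR_const Czero)|].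
  assert (K : (n, m) <> (O, O) ->
    RR (fun Lam xi a b c d =>
      Copp (Cmul (Cmul (Cinv (Csub Cone (multiplier (params Lam xi a b c d) n m)))
                       (Cinv (Csub Cone (multiplier (params Lam xi a b c d) n m))))
        (teval (params Lam xi a b c d) (approx (params Lam xi a b c d) k) remainder n m)))).
  { intros Hnm.
    assert (I : RR (fun Lam xi a b c d =>
       Cinv (Csub Cone (multiplier (params Lam xi a b c d) n m)))).
    { apply RR_inv.
      - apply RR_add; [apply RR_const | apply RR_opp, RR_multiplier].
      - intros. apply one_sub_multiplier_neq0; auto. }
    apply RR_opp, RR_mul; [apply RR_mul; exact I | apply RR_teval; exact IHk]. }
  destruct n, m; [apply (RR_const Czero)| | |]; apply K; discriminate.
Qed.

Lemma RR_xsol n m : RR (fun Lam xi a b c d => xsol (params Lam xi a b c d) n m).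
Proof.
  destruct n.
  - exists (PC Czero), (PC Cone). intros. rewrite xsol_is_xseries. simpl.
    split; [exact (F_1_neq_0 Cx_field_theory)|].
    field. exact (F_1_neq_0 Cx_field_theory).
  - unfold xsol.
    (* [vsol e n m] unfolds to a coefficient of one finite iterate, so no limit of rational
       functions is taken. *)
    destruct (RR_add _ _ (RR_const (fconst Cone n m)) (RR_approx (S (n + m)) n m))
      as (P & Q & H).
    exists P, Q. intros * HD. rewrite fmul_Z1_S. apply H, HD.
Qed.

(** * A submultiplicative norm controlling first-order Taylor remainders *)

(** Points (zeta1, zeta2, Lam). *)
Definition C3 : Type := (Cx * Cx * Cx)%type.
Definition p1 (p : C3) : Cx := fst (fst p).
Definition p2 (p : C3) : Cx := snd (fst p).
Definition p3 (p : C3) : Cx := snd p.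

Definition dist3 (p p' : C3) : R :=
  Cnorm (Csub (p1 p') (p1 p)) + Cnorm (Csub (p2 p') (p2 p)) + Cnorm (Csub (p3 p') (p3 p)).

Definition linear3 (d p p' : C3) : Cx :=
  Cadd (Cadd (Cmul (p1 d) (Csub (p1 p') (p1 p))) (Cmul (p2 d) (Csub (p2 p') (p2 p))))
       (Cmul (p3 d) (Csub (p3 p') (p3 p))).

(** The bounds are demanded for all pairs of points of [U]: the set of values of Lam is an arbitrary
    open set, so a segment between two of its points may leave it and the mean value inequality
    cannot supply them. A quantitative second-order remainder, unlike bare differentiability,
    survives uniform limits. *)
Definition taylor (U : C3 -> Prop) (F : C3 -> Cx) (M0 M1 M2 : R) : Prop :=
  forall p, U p -> Cnorm (F p) <= M0 /\
    exists d : C3, (Cnorm (p1 d) <= M1 /\ Cnorm (p2 d) <= M1 /\ Cnorm (p3 d) <= M1) /\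
      forall p', U p' ->
        Cnorm (Csub (F p') (F p)) <= M1 * dist3 p p' /\
        Cnorm (Csub (Csub (F p') (F p)) (linear3 d p p')) <= M2 * dist3 p p' ^ 2.

(* The bounds (M0, M1, M2) multiply like truncated polynomials M0 + M1 X + M2 X^2,
   so the value at [X = th] is submultiplicative. *)
Definition Nm (U : C3 -> Prop) (th : R) (F : C3 -> Cx) (M : R) : Prop :=
  exists M0 M1 M2, (0 <= M0 /\ 0 <= M1 /\ 0 <= M2) /\ M0 + th * M1 + th ^ 2 * M2 <= M /\
    taylor U F M0 M1 M2.

Section Norm.

Variables (U : C3 -> Prop) (th : R).
Hypothesis Hth : 0 <= th.

Lemma Nm_ge0 F M : Nm U th F M -> 0 <= M.
Proof.
  intros (M0 & M1 & M2 & (H0 & H1 & H2) & HM & _).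
  pose proof (Rmult_le_pos _ _ Hth H1).
  pose proof (Rmult_le_pos _ _ (pow2_ge_0 th) H2). lra.
Qed.

Lemma Nm_mono F M M' : M <= M' -> Nm U th F M -> Nm U th F M'.
Proof.
  intros HM (M0 & M1 & M2 & Hp & HS & H). exists M0, M1, M2.
  split; [auto | split; [lra | auto]].
Qed.

Lemma Nm_restrict (U' : C3 -> Prop) th' F M :
  (forall p, U' p -> U p) -> 0 <= th' <= th -> Nm U th F M -> Nm U' th' F M.
Proof.
  intros HU Ht (M0 & M1 & M2 & (H0 & H1 & H2) & HS & H). exists M0, M1, M2.
  split; [auto|split].
  - pose proof (Rmult_le_compat_r _ _ _ H1 (proj2 Ht)).
    assert (th' ^ 2 <= th ^ 2) by (apply pow_incr; auto).
    pose proof (Rmult_le_compat_r _ _ _ H2 H4). lra.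
  - intros p Hp. destruct (H p (HU p Hp)) as [HF (d & Hd & HD)]. split; auto.
    exists d. split; auto.
Qed.

Lemma Nm_const c : Nm U th (fun _ => c) (Cnorm c).
Proof.
  exists (Cnorm c), 0, 0. split; [pose proof (Cnorm_ge0 c); lra|]. split; [lra|].
  intros p _. split; [lra|]. exists (Czero, Czero, Czero). unfold p1, p2, p3; simpl.
  rewrite Cnorm_0. split; [lra|]. intros p' _. unfold linear3, p1, p2, p3; simpl.
  replace (Csub c c) with Czero by ring. split; [rewrite Cnorm_0; lra|].
  match goal with |- Cnorm ?z <= _ => replace z with Czero by ring end.
  rewrite Cnorm_0; lra.
Qed.

Lemma Nm_ext F G M : (forall p, U p -> F p = G p) -> Nm U th F M -> Nm U th G M.
Proof.
  intros E (M0 & M1 & M2 & Hp & HS & H). exists M0, M1, M2. split; [auto|split; [auto|]].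
  intros p Up. destruct (H p Up) as [HF (d & Hd & HD)]. rewrite <- (E p Up). split; auto.
  exists d. split; auto. intros p' Up'. rewrite <- (E p' Up'). auto.
Qed.

Lemma Nm_0 M : 0 <= M -> Nm U th (fun _ => Czero) M.
Proof. intros H. apply (Nm_mono _ (Cnorm Czero)); [rewrite Cnorm_0; auto | apply Nm_const]. Qed.

Lemma Nm_add F G M N :
  Nm U th F M -> Nm U th G N -> Nm U th (fun p => Cadd (F p) (G p)) (M + N).
Proof.
  intros (M0 & M1 & M2 & (H0 & H1 & H2) & HM & HF) (N0 & N1 & N2 & (G0 & G1 & G2) & HN & HG).
  exists (M0 + N0), (M1 + N1), (M2 + N2). split; [lra|]. split; [lra|].
  intros p Hp. destruct (HF p Hp) as [F0 (d & (D1 & D2 & D3) & FD)].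
  destruct (HG p Hp) as [E0 (d' & (D1' & D2' & D3') & FD')].
  split; [eapply Rle_trans; [apply Cnorm_add|lra]|].
  exists (Cadd (p1 d) (p1 d'), Cadd (p2 d) (p2 d'), Cadd (p3 d) (p3 d')).
  split.
  { split; [|split]; (eapply Rle_trans; [apply Cnorm_add|lra]). }
  intros p' Hp'. destruct (FD p' Hp') as [A B]. destruct (FD' p' Hp') as [A' B'].
  split.
  - replace (Csub (Cadd (F p') (G p')) (Cadd (F p) (G p))) with
      (Cadd (Csub (F p') (F p)) (Csub (G p') (G p))) by ring.
    eapply Rle_trans; [apply Cnorm_add|lra].
  - match goal with |- Cnorm ?z <= _ => replace z with
      (Cadd (Csub (Csub (F p') (F p)) (linear3 d p p'))
            (Csub (Csub (G p') (G p)) (linear3 d' p p')))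
      by (unfold linear3, p1, p2, p3; simpl; ring) end.
    eapply Rle_trans; [apply Cnorm_add|lra].
Qed.

Lemma Cnorm_mul_le z w M N : Cnorm z <= M -> Cnorm w <= N -> Cnorm (Cmul z w) <= M * N.
Proof.
  intros. rewrite Cnorm_mul. apply Rmult_le_compat; auto using Cnorm_ge0.
Qed.

Lemma Cnorm_add_le z w M N : Cnorm z <= M -> Cnorm w <= N -> Cnorm (Cadd z w) <= M + N.
Proof. intros. eapply Rle_trans; [apply Cnorm_add|lra]. Qed.

(** The remainder of a product splits as F times the remainder of G, plus the product of the two
    increments, plus the remainder of F times G. This is the X^2 coefficient of the product of the
    bounding polynomials; the discarded terms in th^3 and th^4 are nonnegative. *)
Lemma Nm_mul F G M N :
  Nm U th F M -> Nm U th G N -> Nm U th (fun p => Cmul (F p) (G p)) (M * N).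
Proof.
  intros (M0 & M1 & M2 & (H0 & H1 & H2) & HM & HF) (N0 & N1 & N2 & (G0 & G1 & G2) & HN & HG).
  pose proof (Rmult_le_pos _ _ H0 G0). pose proof (Rmult_le_pos _ _ H0 G1).
  pose proof (Rmult_le_pos _ _ H0 G2). pose proof (Rmult_le_pos _ _ H1 G0).
  pose proof (Rmult_le_pos _ _ H1 G1). pose proof (Rmult_le_pos _ _ H1 G2).
  pose proof (Rmult_le_pos _ _ H2 G0). pose proof (Rmult_le_pos _ _ H2 G1).
  pose proof (Rmult_le_pos _ _ H2 G2).
  exists (M0 * N0), (M0 * N1 + M1 * N0), (M0 * N2 + M1 * N1 + M2 * N0).
  split; [repeat split; lra|]. split.
  - apply Rle_trans with ((M0 + th * M1 + th ^ 2 * M2) * (N0 + th * N1 + th ^ 2 * N2)).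
    + pose proof (Rmult_le_pos (th ^ 3) (M1 * N2 + M2 * N1) ltac:(apply pow_le; auto) ltac:(lra)).
      pose proof (Rmult_le_pos (th ^ 4) (M2 * N2) ltac:(apply pow_le; auto) ltac:(lra)).
      nra.
    + assert (0 <= th * M1) by (apply Rmult_le_pos; auto).
      assert (0 <= th ^ 2 * M2) by (apply Rmult_le_pos; auto using pow2_ge_0).
      assert (0 <= th * N1) by (apply Rmult_le_pos; auto).
      assert (0 <= th ^ 2 * N2) by (apply Rmult_le_pos; auto using pow2_ge_0).
      apply Rmult_le_compat; lra.
  - intros p Hp. destruct (HF p Hp) as [F0 (d & (D1 & D2 & D3) & FD)].
    destruct (HG p Hp) as [E0 (d' & (D1' & D2' & D3') & FD')].
    split; [apply Cnorm_mul_le; auto|].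
    exists (Cadd (Cmul (F p) (p1 d')) (Cmul (p1 d) (G p)),
            Cadd (Cmul (F p) (p2 d')) (Cmul (p2 d) (G p)),
            Cadd (Cmul (F p) (p3 d')) (Cmul (p3 d) (G p))).
    split.
    { split; [|split]; apply Cnorm_add_le; apply Cnorm_mul_le; auto. }
    intros p' Hp'. destruct (FD p' Hp') as [A B]. destruct (FD' p' Hp') as [A' B'].
    destruct (HG p' Hp') as [E0' _].
    split.
    + replace (Csub (Cmul (F p') (G p')) (Cmul (F p) (G p))) with
        (Cadd (Cmul (F p) (Csub (G p') (G p))) (Cmul (Csub (F p') (F p)) (G p'))) by ring.
      replace ((M0 * N1 + M1 * N0) * dist3 p p') with
        (M0 * (N1 * dist3 p p') + (M1 * dist3 p p') * N0) by ring.
      apply Cnorm_add_le; apply Cnorm_mul_le; auto.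
    + match goal with |- Cnorm ?z <= _ => replace z with
        (Cadd (Cadd (Cmul (F p) (Csub (Csub (G p') (G p)) (linear3 d' p p')))
           (Cmul (Csub (F p') (F p)) (Csub (G p') (G p))))
           (Cmul (Csub (Csub (F p') (F p)) (linear3 d p p')) (G p)))
        by (unfold linear3, p1, p2, p3; simpl; ring) end.
      replace ((M0 * N2 + M1 * N1 + M2 * N0) * dist3 p p' ^ 2) with
        (M0 * (N2 * dist3 p p' ^ 2) + (M1 * dist3 p p') * (N1 * dist3 p p')
         + (M2 * dist3 p p' ^ 2) * N0) by ring.
      apply Cnorm_add_le; [apply Cnorm_add_le|]; apply Cnorm_mul_le; auto.
Qed.

Lemma Nm_opp F M : Nm U th F M -> Nm U th (fun p => Copp (F p)) M.
Proof.
  intros H. replace (fun p => Copp (F p)) with (fun p => Cmul (Copp Cone) (F p)).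
  - rewrite <- (Rmult_1_l M). apply Nm_mul; auto.
    apply (Nm_mono _ (Cnorm (Copp Cone))); [|apply (Nm_const (Copp Cone))].
    rewrite Cnorm_opp, Cnorm_1. lra.
  - extensionality p. ring.
Qed.

Lemma Nm_pow F M n : Nm U th F M -> Nm U th (fun p => Cpow (F p) n) (M ^ n).
Proof.
  intros H. induction n; simpl; [|apply Nm_mul; auto].
  apply (Nm_mono _ (Cnorm Cone)); [rewrite Cnorm_1; lra | apply (Nm_const Cone)].
Qed.

Lemma Nm_sum (F : nat -> C3 -> Cx) (b : nat -> R) n :
  (forall k, (k <= n)%nat -> Nm U th (F k) (b k)) ->
  Nm U th (fun p => Csum (fun k => F k p) n) (sum_f_R0 b n).
Proof. intros H. induction n; simpl; [auto | apply Nm_add; auto]. Qed.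

Lemma Cnorm_one_sub z : 1 - Cnorm z <= Cnorm (Csub Cone z).
Proof.
  pose proof (Cnorm_add (Csub Cone z) z) as H.
  replace (Cadd (Csub Cone z) z) with Cone in H by ring. rewrite Cnorm_1 in H. lra.
Qed.

(** The bounds [g0], [g1], [g2] are the first three coefficients of 1 / (1 - M0 - M1 X - M2 X^2),
    obtained by the usual recursion for an inverse series. Multiplied by 1 minus the polynomial at
    th, their value at th stays below 1, as only nonpositive terms are left over. *)
Lemma Nm_geometric F M :
  M < 1 -> Nm U th F M -> Nm U th (fun p => Cinv (Csub Cone (F p))) (/ (1 - M)).
Proof.
  intros HM1 (M0 & M1 & M2 & (H0 & H1 & H2) & HM & HF).
  assert (T1 : 0 <= th * M1) by (apply Rmult_le_pos; auto).
  assert (T2 : 0 <= th ^ 2 * M2) by (apply Rmult_le_pos; auto using pow2_ge_0).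
  assert (K : forall p, U p -> Csub Cone (F p) <> Czero /\
                Cnorm (Cinv (Csub Cone (F p))) <= / (1 - M0)).
  { intros p Hp. destruct (HF p Hp) as [F0 _]. pose proof (Cnorm_one_sub (F p)).
    assert (Csub Cone (F p) <> Czero).
    { intros E. rewrite E, Cnorm_0 in H. lra. }
    split; auto. rewrite Cnorm_inv by auto. apply Rinv_le_contravar; lra. }
  assert (Hg0 : 0 < / (1 - M0)) by (apply Rinv_0_lt_compat; lra).
  set (g0 := / (1 - M0)) in *.
  assert (Eg : (1 - M0) * g0 = 1) by (unfold g0; field; lra).
  pose (g1 := g0 * (g0 * M1)). pose (g2 := g0 * (g1 * M1 + g0 * M2)).
  assert (Hg1 : 0 <= g1) by (unfold g1; apply Rmult_le_pos; [|apply Rmult_le_pos]; lra).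
  assert (Hg2 : 0 <= g2).
  { unfold g2. apply Rmult_le_pos; [lra|]. apply Rplus_le_le_0_compat; apply Rmult_le_pos; lra. }
  exists g0, g1, g2. split; [lra|]. split.
  - apply Rmult_le_reg_l with (1 - M); [lra|]. rewrite Rinv_r by lra.
    assert (HS : 0 <= g0 + th * g1 + th ^ 2 * g2).
    { pose proof (Rmult_le_pos _ _ Hth Hg1).
      pose proof (Rmult_le_pos _ _ (pow2_ge_0 th) Hg2). lra. }
    apply Rle_trans with ((1 - (M0 + th * M1 + th ^ 2 * M2)) * (g0 + th * g1 + th ^ 2 * g2)).
    { apply Rmult_le_compat_r; lra. }
    assert (E1 : (1 - M0) * g1 = g0 * M1).
    { unfold g1. replace ((1 - M0) * (g0 * (g0 * M1))) with ((1 - M0) * g0 * (g0 * M1)) by ring.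
      rewrite Eg. ring. }
    assert (E2 : (1 - M0) * g2 = g1 * M1 + g0 * M2).
    { unfold g2. rewrite <- Rmult_assoc, Eg. ring. }
    replace ((1 - (M0 + th * M1 + th ^ 2 * M2)) * (g0 + th * g1 + th ^ 2 * g2)) with
      ((1 - M0) * g0 + th * ((1 - M0) * g1) - th * M1 * g0
       + th ^ 2 * ((1 - M0) * g2) - th ^ 2 * (M1 * g1 + M2 * g0)
       - (th * M1 * (th ^ 2 * g2) + th ^ 2 * M2 * (th * g1) + th ^ 2 * M2 * (th ^ 2 * g2)))
      by ring.
    rewrite Eg, E1, E2.
    assert (0 <= th * M1 * (th ^ 2 * g2))
      by (apply Rmult_le_pos; auto; apply Rmult_le_pos; auto using pow2_ge_0).
    assert (0 <= th ^ 2 * M2 * (th * g1))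
      by (apply Rmult_le_pos; auto; apply Rmult_le_pos; auto).
    assert (0 <= th ^ 2 * M2 * (th ^ 2 * g2))
      by (apply Rmult_le_pos; auto; apply Rmult_le_pos; auto using pow2_ge_0).
    lra.
  - intros p Hp. destruct (K p Hp) as [Np Gp].
    destruct (HF p Hp) as [F0 (d & (D1 & D2 & D3) & FD)]. split; [auto|].
    set (G := Cinv (Csub Cone (F p))) in *.
    exists (Cmul G (Cmul G (p1 d)), Cmul G (Cmul G (p2 d)), Cmul G (Cmul G (p3 d))).
    split.
    { split; [|split]; apply Cnorm_mul_le; auto; apply Cnorm_mul_le; auto. }
    intros p' Hp'. destruct (K p' Hp') as [Np' Gp']. destruct (FD p' Hp') as [A B].
    set (G' := Cinv (Csub Cone (F p'))) in *.
    assert (E : Csub G' G = Cmul G' (Cmul G (Csub (F p') (F p)))).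
    { unfold G, G'. field. auto. }
    assert (L1 : Cnorm (Csub G' G) <= g1 * dist3 p p').
    { rewrite E. unfold g1.
      replace (g0 * (g0 * M1) * dist3 p p') with (g0 * (g0 * (M1 * dist3 p p'))) by ring.
      apply Cnorm_mul_le; auto; apply Cnorm_mul_le; auto. }
    split; [exact L1|].
    match goal with |- Cnorm ?z <= _ => replace z with
      (Cmul G (Cadd (Cmul (Csub G' G) (Csub (F p') (F p)))
         (Cmul G (Csub (Csub (F p') (F p)) (linear3 d p p'))))) end.
    + unfold g2.
      replace (g0 * (g1 * M1 + g0 * M2) * dist3 p p' ^ 2) with
        (g0 * ((g1 * dist3 p p') * (M1 * dist3 p p') + g0 * (M2 * dist3 p p' ^ 2))) by ring.
      apply Cnorm_mul_le; auto. apply Cnorm_add_le; apply Cnorm_mul_le; auto.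
    + rewrite E at 2. unfold linear3, p1, p2, p3; simpl. ring.
Qed.

Lemma Nm_coord (pr : C3 -> Cx) r :
  (pr = p1 \/ pr = p2 \/ pr = p3) -> 0 <= r -> (forall p, U p -> Cnorm (pr p) <= r) ->
  Nm U th pr (r + th).
Proof.
  intros Hpr Hr HU. exists r, 1, 0. split; [lra|]. split; [lra|].
  intros p Hp. split; [auto|].
  destruct Hpr as [-> | [-> | ->]];
    [exists (Cone, Czero, Czero) | exists (Czero, Cone, Czero) | exists (Czero, Czero, Cone)];
    (split; [unfold p1, p2, p3; simpl; rewrite ?Cnorm_1, ?Cnorm_0; lra|]);
    intros p' Hp';
    (split; [unfold dist3; pose proof (Cnorm_ge0 (Csub (p1 p') (p1 p)));
       pose proof (Cnorm_ge0 (Csub (p2 p') (p2 p)));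
       pose proof (Cnorm_ge0 (Csub (p3 p') (p3 p))); lra|]);
    match goal with |- Cnorm ?z <= _ => replace z with Czero
      by (unfold linear3; simpl; unfold p1, p2, p3; simpl; ring) end;
    rewrite Cnorm_0; lra.
Qed.

(** For 1/l the derivative is -1/l^2 and the remainder is h^2 / (l' l^2); as all inverses have
    modulus at most 1, M1 = M2 = 1 serve. *)
Lemma Nm_inv_p3 r :
  0 <= r <= 1 -> (forall p, U p -> p3 p <> Czero /\ / Cnorm (p3 p) <= r) ->
  Nm U th (fun p => Cinv (p3 p)) (r + th + th ^ 2).
Proof.
  intros Hr HU.
  exists r, 1, 1. split; [lra|]. split; [lra|].
  assert (K : forall p, U p -> Cnorm (Cinv (p3 p)) <= r).
  { intros p Hp. destruct (HU p Hp). rewrite Cnorm_inv; auto. }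
  assert (K1 : forall p, U p -> Cnorm (Cinv (p3 p)) <= 1).
  { intros p Hp. specialize (K p Hp). lra. }
  intros p Hp. split; [auto|].
  exists (Czero, Czero, Copp (Cmul (Cinv (p3 p)) (Cinv (p3 p)))).
  split.
  { unfold p1, p2, p3 at 1; simpl. rewrite Cnorm_0, Cnorm_opp. split; [lra|split; [lra|]].
    rewrite <- (Rmult_1_l 1). apply Cnorm_mul_le; auto. }
  intros p' Hp'. destruct (HU p Hp) as [N _]. destruct (HU p' Hp') as [N' _].
  assert (Dp : Cnorm (Csub (p3 p') (p3 p)) <= dist3 p p').
  { unfold dist3. pose proof (Cnorm_ge0 (Csub (p1 p') (p1 p))).
    pose proof (Cnorm_ge0 (Csub (p2 p') (p2 p))). lra. }
  split.
  - replace (Csub (Cinv (p3 p')) (Cinv (p3 p))) with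
      (Copp (Cmul (Cinv (p3 p')) (Cmul (Cinv (p3 p)) (Csub (p3 p') (p3 p)))))
      by (field; auto).
    rewrite Cnorm_opp. replace (1 * dist3 p p') with (1 * (1 * dist3 p p')) by ring.
    apply Cnorm_mul_le; auto. apply Cnorm_mul_le; auto.
  - match goal with |- Cnorm (Csub ?z _) <= _ => replace (Csub z _) with
      (Cmul (Cinv (p3 p')) (Cmul (Cmul (Cinv (p3 p)) (Cinv (p3 p)))
         (Cmul (Csub (p3 p') (p3 p)) (Csub (p3 p') (p3 p)))))
      by (unfold linear3, p1, p2, p3 in *; cbn [fst snd]; field; auto) end.
    replace (1 * dist3 p p' ^ 2) with (1 * ((1 * 1) * (dist3 p p' * dist3 p p'))) by ring.
    apply Cnorm_mul_le; auto. apply Cnorm_mul_le; apply Cnorm_mul_le; auto.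
Qed.

End Norm.

(** * Majorants *)

(** With r^n alone a convolution would lose a factor n + 1. The summable weight 1/(n+1)^2 reduces
    the loss to the constant 8, so that the weighted bounds are stable under products. *)
Definition omega (r : R) (n : nat) : R := / INR (S n) ^ 2 * r ^ n.

Lemma INR_S_pos n : 0 < INR (S n).
Proof. apply lt_0_INR; lia. Qed.

Lemma omega_pos r n : 0 < r -> 0 < omega r n.
Proof.
  intros. apply Rmult_lt_0_compat; [|apply pow_lt; auto].
  apply Rinv_0_lt_compat, pow_lt, INR_S_pos.
Qed.

Lemma sum_inv_sq n : sum_f_R0 (fun k => / INR (S k) ^ 2) n <= 2 - / INR (S n).
Proof.
  induction n; [simpl; lra|].
  rewrite tech5. eapply Rle_trans; [apply Rplus_le_compat_r, IHn|].
  pose proof (INR_S_pos n). rewrite (S_INR (S n)). set (x := INR (S n)) in *.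
  assert (/ (x + 1) ^ 2 <= / x - / (x + 1)); [|lra].
  replace (/ x - / (x + 1)) with (/ (x * (x + 1))) by (field; lra).
  apply Rinv_le_contravar; nra.
Qed.

Lemma sum_f_R0_rev (f : nat -> R) n : sum_f_R0 f n = sum_f_R0 (fun k => f (n - k)%nat) n.
Proof.
  assert (E : forall g k, sum_f_R0 g k = psum R Rplus g k).
  { intros g k. induction k; simpl; [|rewrite IHk]; reflexivity. }
  rewrite !E. apply (psum_rev _ _ _ _ _ _ _ RTheory).
Qed.

(** For x = k + 1 and y = n - k + 1, (n+1)^2 <= (x+y)^2 <= 2 (x^2 + y^2), whence 1/(x^2 y^2) <=
    2/(n+1)^2 (1/x^2 + 1/y^2). Each of the two sums is at most 2, which gives 8. *)
Lemma sum_inv_sq_conv n :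
  sum_f_R0 (fun k => / INR (S k) ^ 2 * / INR (S (n - k)) ^ 2) n <= 8 * / INR (S n) ^ 2.
Proof.
  pose proof (INR_S_pos n) as Hn.
  apply Rle_trans with (sum_f_R0 (fun k => (/ INR (S k) ^ 2 + / INR (S (n - k)) ^ 2)
                                            * (2 * / INR (S n) ^ 2)) n).
  - apply sum_Rle. intros k Hk.
    pose proof (INR_S_pos k) as Hx. pose proof (INR_S_pos (n - k)) as Hy.
    assert (Hs : INR (S n) <= INR (S k) + INR (S (n - k))).
    { rewrite <- plus_INR. apply le_INR. lia. }
    set (x := INR (S k)) in *. set (y := INR (S (n - k))) in *. set (s := INR (S n)) in *.
    replace (/ x ^ 2 * / y ^ 2) with (/ (x * y) ^ 2) by (field; lra).
    replace ((/ x ^ 2 + / y ^ 2) * (2 * / s ^ 2)) with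
      (/ (x * y) ^ 2 * ((2 * (x ^ 2 + y ^ 2)) * / s ^ 2)) by (field; lra).
    rewrite <- (Rmult_1_r (/ (x * y) ^ 2)) at 1.
    apply Rmult_le_compat_l.
    + left. apply Rinv_0_lt_compat, pow_lt, Rmult_lt_0_compat; auto.
    + apply Rmult_le_reg_r with (s ^ 2); [apply pow_lt; auto|].
      rewrite Rmult_assoc, Rinv_l, Rmult_1_r, Rmult_1_l by (apply pow_nonzero; lra).
      apply Rle_trans with ((x + y) ^ 2); [apply pow_incr; lra|].
      pose proof (pow2_ge_0 (x - y)). lra.
  - rewrite <- scal_sum. rewrite sum_plus.
    rewrite <- (sum_f_R0_rev (fun k => / INR (S k) ^ 2)).
    pose proof (sum_inv_sq n) as HS. pose proof (Rinv_0_lt_compat _ Hn).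
    pose proof (Rinv_0_lt_compat _ (pow_lt _ 2 Hn)). nra.
Qed.

Lemma omega_conv r n : 0 < r ->
  sum_f_R0 (fun k => omega r k * omega r (n - k)) n <= 8 * omega r n.
Proof.
  intros Hr. unfold omega.
  rewrite (sum_eq _ (fun k => (/ INR (S k) ^ 2 * / INR (S (n - k)) ^ 2) * r ^ n)).
  - rewrite <- scal_sum. pose proof (sum_inv_sq_conv n). pose proof (pow_lt r n Hr).
    rewrite <- Rmult_assoc, (Rmult_comm (r ^ n)). apply Rmult_le_compat_r; lra.
  - intros k Hk. replace (r ^ n) with (r ^ k * r ^ (n - k))
      by (rewrite <- pow_add; f_equal; lia). ring.
Qed.

Section Majorant.

Variables (U : C3 -> Prop) (th : R).
Hypothesis Hth : 0 <= th.

(** The divisor 64 = 8 * 8 absorbs the constant lost by convolution in each of the two indices,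
    making the bound exactly submultiplicative. *)
Definition Bd (r : R) (f : C3 -> FS) (M : R) : Prop :=
  0 <= M /\ forall n m, Nm U th (fun p => f p n m) (M / 64 * (omega r n * omega r m)).

Section Weight.

Variable r : R.
Hypothesis Hr : 0 < r.

Lemma weight_pos n m : 0 < omega r n * omega r m.
Proof. apply Rmult_lt_0_compat; apply omega_pos; auto. Qed.

Lemma Bd_mono f M M' : M <= M' -> Bd r f M -> Bd r f M'.
Proof.
  intros H [H0 HB]. split; [lra|]. intros n m. eapply Nm_mono; [|apply HB].
  apply Rmult_le_compat_r; [left; apply weight_pos|lra].
Qed.

Lemma Bd_add f g M N : Bd r f M -> Bd r g N -> Bd r (fun p => fadd (f p) (g p)) (M + N).
Proof.
  intros [H0 HB] [H0' HB']. split; [lra|]. intros n m.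
  replace ((M + N) / 64 * (omega r n * omega r m)) with
   (M / 64 * (omega r n * omega r m) + N / 64 * (omega r n * omega r m)) by field.
  apply Nm_add; auto.
Qed.

Lemma Bd_opp f M : Bd r f M -> Bd r (fun p => fopp (f p)) M.
Proof. intros [H0 HB]. split; [auto|]. intros n m. apply Nm_opp; auto. Qed.

Lemma Bd_mul f g M N : Bd r f M -> Bd r g N -> Bd r (fun p => fmul (f p) (g p)) (M * N).
Proof.
  intros [H0 HB] [H0' HB']. split; [apply Rmult_le_pos; auto|]. intros n m.
  apply Nm_mono with (sum_f_R0 (fun k => sum_f_R0 (fun l =>
     (M / 64 * (omega r k * omega r l)) *
     (N / 64 * (omega r (n - k) * omega r (m - l)))) m) n).
  - rewrite (sum_eq _ (fun k => (omega r k * omega r (n - k)) *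
       (sum_f_R0 (fun l => omega r l * omega r (m - l)) m * (M * N / 64 / 64)))).
    + rewrite <- scal_sum.
      pose proof (omega_conv r n Hr) as Hn. pose proof (omega_conv r m Hr) as Hm.
      assert (P : 0 <= sum_f_R0 (fun k => omega r k * omega r (n - k)) n).
      { apply cond_pos_sum. intros. left. apply weight_pos. }
      assert (P' : 0 <= sum_f_R0 (fun k => omega r k * omega r (m - k)) m).
      { apply cond_pos_sum. intros. left. apply weight_pos. }
      pose proof (Rmult_le_compat _ _ _ _ P P' Hn Hm) as HH.
      assert (Q : 0 <= M * N / 64 / 64) by (pose proof (Rmult_le_pos _ _ H0 H0'); lra).
      pose proof (Rmult_le_compat_r _ _ _ Q HH). lra.
    + intros k Hk. rewrite (Rmult_comm (sum_f_R0 _ m)), scal_sum.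
      rewrite scal_sum. apply sum_eq. intros. field.
  - unfold fmul. apply (Nm_sum _ _ (fun k p => Csum (fun l => _) m)). intros k Hk.
    apply (Nm_sum _ _ (fun l p => Cmul _ _)). intros l Hl. apply Nm_mul; auto.
Qed.

Lemma Bd_const (F : C3 -> Cx) K : Nm U th F K -> Bd r (fun p => fconst (F p)) (64 * K).
Proof.
  intros H. pose proof (Nm_ge0 _ _ Hth _ _ H). split; [lra|]. intros n m.
  assert (P : 0 <= 64 * K / 64 * (omega r n * omega r m)).
  { apply Rmult_le_pos; [lra | left; apply weight_pos]. }
  destruct n, m; try (apply Nm_0; assumption).
  eapply Nm_mono; [|exact H]. unfold omega. simpl. lra.
Qed.

Lemma Nm_one M : 1 <= M -> Nm U th (fun _ => Cone) M.
Proof. intros. apply (Nm_mono _ _ _ (Cnorm Cone)); [rewrite Cnorm_1; auto | apply Nm_const]. Qed.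

(** 256 = 64 * 4, since [omega r 1] is r / 4. A large r thus makes the variables small. *)
Lemma Bd_Z1 : Bd r (fun _ => Z1) (256 / r).
Proof.
  assert (P0 : 0 < 256 / r) by (apply Rdiv_lt_0_compat; lra).
  split; [lra|]. intros n m.
  assert (P : 0 <= 256 / r / 64 * (omega r n * omega r m)).
  { apply Rmult_le_pos; [lra | left; apply weight_pos]. }
  destruct n as [|[|n]], m; try (apply Nm_0; assumption).
  apply Nm_one. unfold omega. simpl. right. field. lra.
Qed.

Lemma Bd_Z2 : Bd r (fun _ => Z2) (256 / r).
Proof.
  assert (P0 : 0 < 256 / r) by (apply Rdiv_lt_0_compat; lra).
  split; [lra|]. intros n m.
  assert (P : 0 <= 256 / r / 64 * (omega r n * omega r m)).
  { apply Rmult_le_pos; [lra | left; apply weight_pos]. }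
  destruct n, m as [|[|m]]; try (apply Nm_0; assumption).
  apply Nm_one. unfold omega. simpl. right. field. lra.
Qed.

Lemma Bd_fdil (al be : C3 -> Cx) f M :
  Nm U th al 1 -> Nm U th be 1 -> Bd r f M -> Bd r (fun p => fdil (al p) (be p) (f p)) M.
Proof.
  intros Ha Hb [H0 HB]. split; [auto|]. intros n m.
  rewrite <- (Rmult_1_l (M / 64 * _)). apply Nm_mul; auto.
  rewrite <- (Rmult_1_l 1). apply Nm_mul; auto.
  - rewrite <- (pow1 n). apply Nm_pow; auto.
  - rewrite <- (pow1 m). apply Nm_pow; auto.
Qed.

End Weight.

Variable e : C3 -> nat -> Cx.
Variable rho : R.
Hypothesis Hrho : 0 <= rho < 1.
Hypothesis He : forall k, exists K, Nm U th (fun p => e p k) K.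
Hypothesis He0 : Nm U th (fun p => e p O) rho.
Hypothesis He1 : Nm U th (fun p => e p 1%nat) rho.

(** For the radius parameter 256 / s^2 the variables have size s^2 and v has size s, exactly the
    weights counted by [ord]. The constant depends neither on s nor on v, which leaves s free to be
    chosen small afterwards. *)
Lemma Bd_teval t : exists K, 0 <= K /\ forall s v, 0 < s <= 1 ->
  Bd (256 / s ^ 2) v s ->
  Bd (256 / s ^ 2) (fun p => teval (e p) (v p) t) (K * s ^ ord t).
Proof.
  assert (Pr : forall s, 0 < s <= 1 -> 0 < 256 / s ^ 2).
  { intros. apply Rdiv_lt_0_compat; [lra | apply pow_lt; lra]. }
  assert (Hpow : forall s i j, 0 < s <= 1 -> (i <= j)%nat -> s ^ j <= s ^ i).
  { intros s i j Hs Hij. replace j with (i + (j - i))%nat by lia. rewrite pow_add.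
    pose proof (pow_lt s i (proj1 Hs)).
    assert (s ^ (j - i) <= 1) by (rewrite <- (pow1 (j - i)); apply pow_incr; lra).
    nra. }
  induction t as [|k| | |i|t1 IHt1 t2 IHt2|t1 IHt1 t2 IHt2|t IHt]; simpl teval; simpl ord.
  - exists 64. split; [lra|]. intros s v Hs Hv. rewrite pow_O.
    apply (Bd_const _ (Pr s Hs) (fun _ => Cone)). apply (Nm_one 1). lra.
  - destruct (He k) as [K HK]. pose proof (Nm_ge0 _ _ Hth _ _ HK).
    exists (64 * K). split; [lra|]. intros s v Hs Hv. rewrite pow_O, Rmult_1_r.
    apply (Bd_const _ (Pr s Hs) _ _ HK).
  - exists 1. split; [lra|]. intros s v Hs Hv.
    replace (1 * s ^ 2) with (256 / (256 / s ^ 2)) by (field; lra). apply Bd_Z1; auto.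
  - exists 1. split; [lra|]. intros s v Hs Hv.
    replace (1 * s ^ 2) with (256 / (256 / s ^ 2)) by (field; lra). apply Bd_Z2; auto.
  - exists 1. split; [lra|]. intros s v Hs Hv. rewrite Rmult_1_l, pow_1.
    induction i; simpl; [exact Hv|].
    apply (Bd_fdil _ (fun p => e p O) (fun p => e p 1%nat)); auto;
      eapply Nm_mono; eauto; lra.
  - destruct IHt1 as (K1 & P1 & IH1), IHt2 as (K2 & P2 & IH2).
    exists (K1 + K2). split; [lra|]. intros s v Hs Hv.
    rewrite Rmult_plus_distr_r. apply Bd_add; (eapply Bd_mono; [| |eauto]); auto;
      apply Rmult_le_compat_l; auto; apply Hpow; auto; lia.
  - destruct IHt1 as (K1 & P1 & IH1), IHt2 as (K2 & P2 & IH2).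
    exists (K1 * K2). split; [apply Rmult_le_pos; auto|]. intros s v Hs Hv.
    rewrite pow_add.
    replace (K1 * K2 * (s ^ ord t1 * s ^ ord t2)) with
      ((K1 * s ^ ord t1) * (K2 * s ^ ord t2)) by ring.
    apply Bd_mul; auto.
  - destruct IHt as (K & P & IH). exists K. split; auto. intros. apply Bd_opp; auto.
Qed.

Lemma Nm_inv_one_sub_multiplier n m : (n, m) <> (O, O) ->
  Nm U th (fun p => Cinv (Csub Cone (multiplier (e p) n m))) (/ (1 - rho)).
Proof.
  intros Hnm.
  assert (H : Nm U th (fun p => multiplier (e p) n m) rho).
  { apply Nm_mono with (rho ^ n * rho ^ m); [|apply Nm_mul; auto; apply Nm_pow; auto].
    rewrite <- pow_add. destruct (n + m)%nat eqn:E; [exfalso; apply Hnm; f_equal; lia|].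
    simpl. assert (rho ^ n0 <= 1) by (rewrite <- (pow1 n0); apply pow_incr; lra).
    pose proof (pow_le rho n0 (proj1 Hrho)). nra. }
  apply Nm_geometric; auto. lra.
Qed.

(** Dividing by the square of 1 - Q costs the fixed factor [C], while the remainder has order two
    and is at most K s^2; for small s the result falls back into the ball of radius s. *)
Lemma Bd_approx : exists s, 0 < s <= 1 /\ forall k, Bd (256 / s ^ 2) (fun p => approx (e p) k) s.
Proof.
  destruct (Bd_teval remainder) as (K & HK & H).
  pose (C := / (1 - rho) * / (1 - rho)).
  assert (HC : 0 < C) by (apply Rmult_lt_0_compat; apply Rinv_0_lt_compat; lra).
  (* This choice gives C K s <= 1, hence C K s^2 <= s; the added 1 ensures s <= 1. *)
  pose (s := / (C * K + 1)). exists s.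
  assert (P : 0 <= C * K) by (apply Rmult_le_pos; lra).
  assert (Hs0 : 0 < s) by (apply Rinv_0_lt_compat; lra).
  assert (Hs1 : (C * K + 1) * s = 1) by (unfold s; field; lra).
  assert (Hs : 0 < s <= 1) by nra. split; [exact Hs|].
  assert (Hr : 0 < 256 / s ^ 2) by (apply Rdiv_lt_0_compat; [lra | apply pow_lt; lra]).
  induction k; simpl.
  - split; [lra|]. intros n m. apply Nm_0. apply Rmult_le_pos; [lra | left; apply weight_pos; auto].
  - specialize (H s _ Hs IHk).
    assert (Ho : s ^ ord remainder <= s ^ 2).
    { pose proof ord_remainder. replace (ord remainder) with (2 + (ord remainder - 2))%nat by lia.
      rewrite pow_add.
      assert (s ^ (ord remainder - 2) <= 1)
        by (rewrite <- (pow1 (ord remainder - 2)); apply pow_incr; lra).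
      pose proof (pow_lt s 2 Hs0). nra. }
    assert (B : Bd (256 / s ^ 2) (fun p => teval (e p) (approx (e p) k) remainder) (K * s ^ 2)).
    { eapply Bd_mono; [auto| |exact H]. apply Rmult_le_compat_l; auto. }
    split; [lra|]. intros n m. destruct B as [_ B]. specialize (B n m).
    pose proof (weight_pos _ Hr n m) as Hw.
    set (w := omega _ n * omega _ m) in *.
    assert (G : (n, m) <> (O, O) -> Nm U th (fun p =>
      Copp (Cmul (Cmul (Cinv (Csub Cone (multiplier (e p) n m)))
                             (Cinv (Csub Cone (multiplier (e p) n m))))
                       (teval (e p) (approx (e p) k) remainder n m))) (s / 64 * w)).
    { intros Hnm. apply Nm_opp; auto.
      apply Nm_mono with (C * (K * s ^ 2 / 64 * w)).
      - assert (C * K * s ^ 2 <= s) by nra. nra.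
      - apply Nm_mul; auto. apply Nm_mul; auto; apply Nm_inv_one_sub_multiplier; auto. }
    assert (P0 : 0 <= s / 64 * w) by (apply Rmult_le_pos; lra).
    destruct n, m; [apply Nm_0; auto | | |]; apply G; discriminate.
Qed.

Lemma Nm_xsol : exists A r, 0 < A /\ 1 <= r /\
  forall n m, Nm U th (fun p => xsol (e p) n m) (A * r ^ (n + m)).
Proof.
  (* The constant 2 covers the 1 in 1 + v and the coefficient of v, bounded by s / 64 times the
     weight; the extra index from multiplication by zeta1 is absorbed by r >= 1. *)
  destruct Bd_approx as (s & Hs & H). exists 2, (256 / s ^ 2).
  assert (Hs2 : 0 < s ^ 2 <= 1) by (split; [apply pow_lt; lra | simpl; nra]).
  assert (Hr : 1 <= 256 / s ^ 2).
  { apply Rmult_le_reg_r with (s ^ 2); [lra|]. unfold Rdiv.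
    rewrite Rmult_assoc, Rinv_l by lra. lra. }
  set (r := 256 / s ^ 2) in *.
  split; [lra|]. split; [auto|]. intros n m.
  assert (R1 : forall j, 1 <= r ^ j) by (intros; apply pow_R1_Rle; auto).
  destruct n.
  - replace (fun p => xsol (e p) 0%nat m) with (fun _ : C3 => Czero).
    + apply Nm_0. pose proof (R1 (0 + m)%nat). lra.
    + extensionality p. symmetry. apply xsol_is_xseries.
  - replace (fun p => xsol (e p) (S n) m) with
      (fun p => Cadd (fconst Cone n m) (approx (e p) (S (n + m)) n m)).
    2:{ extensionality p. unfold xsol. rewrite fmul_Z1_S. reflexivity. }
    pose proof (R1 (n + m)%nat) as Hnm.
    apply Nm_mono with (1 + r ^ (n + m)).
    + change (S n + m)%nat with (S (n + m)). simpl. nra.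
    + apply Nm_add; auto.
      * apply (Nm_mono _ _ _ (Cnorm (fconst Cone n m))); [|apply (Nm_const U th (fconst Cone n m))].
        destruct n, m; simpl; rewrite ?Cnorm_1, ?Cnorm_0; lra.
      * destruct (H (S (n + m))) as [_ HB]. eapply Nm_mono; [|apply HB].
        assert (W : forall j, 0 < omega r j <= r ^ j).
        { intros j. split; [apply omega_pos; lra|]. unfold omega.
          pose proof (R1 j). rewrite <- (Rmult_1_l (r ^ j)) at 2.
          apply Rmult_le_compat_r; [lra|]. rewrite <- Rinv_1. apply Rinv_le_contravar; [lra|].
          apply pow_R1_Rle. rewrite S_INR. pose proof (pos_INR j). lra. }
        rewrite pow_add. destruct (W n), (W m).
        assert (omega r n * omega r m <= r ^ n * r ^ m) by (apply Rmult_le_compat; lra).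
        assert (0 < omega r n * omega r m) by (apply Rmult_lt_0_compat; auto).
        assert (s / 64 <= 1) by lra. nra.
Qed.

End Majorant.

(** * Limits of geometrically convergent sequences *)

Lemma half_pow_pos N : 0 < (1 / 2) ^ N.
Proof. apply pow_lt. lra. Qed.

Lemma half_pow_small C eps : 0 < eps -> exists N0, forall N, (N0 <= N)%nat -> C * (1 / 2) ^ N < eps.
Proof.
  intros He. destruct (Rle_lt_dec C 0) as [HC|HC].
  { exists O. intros N _. pose proof (half_pow_pos N). nra. }
  assert (Hq : 0 < eps / C) by (apply Rdiv_lt_0_compat; auto).
  destruct (pow_lt_1_zero (1 / 2) ltac:(rewrite Rabs_pos_eq; lra) _ Hq) as [N0 H0].
  exists N0. intros N HN. specialize (H0 N HN).
  rewrite Rabs_pos_eq in H0 by (left; apply half_pow_pos).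
  apply Rmult_lt_compat_l with (r := C) in H0; [|auto].
  replace (C * (eps / C)) with eps in H0 by (field; lra). exact H0.
Qed.

Lemma le_of_half_pow x y C : (forall N, x <= y + C * (1 / 2) ^ N) -> x <= y.
Proof.
  intros H. apply le_epsilon. intros eps He.
  destruct (half_pow_small C eps He) as [N HN]. specialize (HN N (le_n N)).
  specialize (H N). lra.
Qed.

Lemma R_geometric_limit (u : nat -> R) A :
  (forall N, Rabs (u (S N) - u N) <= A * (1 / 2) ^ N) -> exists l, Un_cv u l.
Proof.
  intros H.
  assert (HA : 0 <= A).
  { specialize (H O). pose proof (Rabs_pos (u 1%nat - u O)). simpl in H. lra. }
  assert (K : forall N j, Rabs (u (N + j)%nat - u N) <= 2 * A * (1 / 2) ^ N * (1 - (1 / 2) ^ j)).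
  { intros N j. induction j.
    - rewrite Nat.add_0_r. replace (u N - u N) with 0 by ring. rewrite Rabs_R0. simpl. lra.
    - rewrite Nat.add_succ_r.
      replace (u (S (N + j)) - u N) with ((u (S (N + j)) - u (N + j)%nat) + (u (N + j)%nat - u N))
        by ring.
      eapply Rle_trans; [apply Rabs_triang|]. specialize (H (N + j)%nat).
      rewrite pow_add in H. simpl. lra. }
  assert (HC : Cauchy_crit u).
  { intros eps He. destruct (half_pow_small (2 * A) (eps / 2) ltac:(lra)) as [N0 H0].
    exists N0.
    assert (L : forall n, (n >= N0)%nat -> Rabs (u n - u N0) < eps / 2).
    { intros n Hn. replace n with (N0 + (n - N0))%nat by lia.
      eapply Rle_lt_trans; [apply K|]. specialize (H0 N0 (le_n _)).
      pose proof (half_pow_pos (n - N0)). pose proof (half_pow_pos N0).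
      assert (0 <= 2 * A * (1 / 2) ^ N0) by (apply Rmult_le_pos; lra). nra. }
    intros n m Hn Hm. unfold Rdist.
    replace (u n - u m) with ((u n - u N0) - (u m - u N0)) by ring.
    eapply Rle_lt_trans; [apply Rabs_triang|]. rewrite Rabs_Ropp.
    specialize (L n Hn) as L1. specialize (L m Hm) as L2. lra. }
  destruct (R_complete u HC) as [l Hl]. exists l. exact Hl.
Qed.

Lemma Cx_geometric_limit (z : nat -> Cx) A :
  (forall N, Cnorm (Csub (z (S N)) (z N)) <= A * (1 / 2) ^ N) ->
  exists l, forall N, Cnorm (Csub (z N) l) <= 2 * A * (1 / 2) ^ N.
Proof.
  intros H.
  assert (HA : 0 <= A).
  { specialize (H O). pose proof (Cnorm_ge0 (Csub (z 1%nat) (z O))). simpl in H. lra. }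
  destruct (R_geometric_limit (fun N => re (z N)) A) as [x Hx].
  { intros N. eapply Rle_trans; [|apply H]. apply (re_le_Cnorm (Csub (z (S N)) (z N))). }
  destruct (R_geometric_limit (fun N => im (z N)) A) as [y Hy].
  { intros N. eapply Rle_trans; [|apply H]. apply (im_le_Cnorm (Csub (z (S N)) (z N))). }
  exists (mkC x y). intros N.
  assert (K : forall j, Cnorm (Csub (z N) (z (N + j)%nat)) <= 2 * A * (1 / 2) ^ N * (1 - (1 / 2) ^ j)).
  { induction j.
    - rewrite Nat.add_0_r. replace (Csub (z N) (z N)) with Czero by ring. rewrite Cnorm_0. simpl. lra.
    - rewrite Nat.add_succ_r.
      replace (Csub (z N) (z (S (N + j)))) with
       (Cadd (Csub (z N) (z (N + j)%nat)) (Csub (z (N + j)%nat) (z (S (N + j))))) by ring.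
      eapply Rle_trans; [apply Cnorm_add|]. specialize (H (N + j)%nat).
      rewrite Cnorm_sub_sym, pow_add in H. simpl. lra. }
  apply le_epsilon. intros eps He.
  destruct (Hx (eps / 2) ltac:(lra)) as [N1 H1]. destruct (Hy (eps / 2) ltac:(lra)) as [N2 H2].
  pose (j := (N1 + N2)%nat). specialize (H1 (N + j)%nat ltac:(lia)). specialize (H2 (N + j)%nat ltac:(lia)).
  unfold Rdist in *.
  replace (Csub (z N) (mkC x y)) with
    (Cadd (Csub (z N) (z (N + j)%nat)) (Csub (z (N + j)%nat) (mkC x y))) by ring.
  eapply Rle_trans; [apply Cnorm_add|]. apply Rplus_le_compat.
  - eapply Rle_trans; [apply K|]. pose proof (half_pow_pos j). pose proof (half_pow_pos N).
    assert (0 <= 2 * A * (1 / 2) ^ N) by (apply Rmult_le_pos; lra). nra.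
  - eapply Rle_trans; [apply Cnorm_le_re_im|]. simpl. unfold Rminus in *. lra.
Qed.

Definition dsub3 (d d' : C3) : C3 := (Csub (p1 d) (p1 d'), Csub (p2 d) (p2 d'), Csub (p3 d) (p3 d')).
Definition dadd3 (d d' : C3) : C3 := (Cadd (p1 d) (p1 d'), Cadd (p2 d) (p2 d'), Cadd (p3 d) (p3 d')).

Lemma linear3_le d p p' M :
  Cnorm (p1 d) <= M -> Cnorm (p2 d) <= M -> Cnorm (p3 d) <= M ->
  Cnorm (linear3 d p p') <= M * dist3 p p'.
Proof.
  intros. unfold linear3, dist3. rewrite !Rmult_plus_distr_l.
  apply Cnorm_add_le; [apply Cnorm_add_le|]; apply Cnorm_mul_le; auto; lra.
Qed.

Lemma Nm_remainder U th F M p : 0 < th -> Nm U th F M -> U p ->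
  exists d : C3, (Cnorm (p1 d) <= M / th /\ Cnorm (p2 d) <= M / th /\ Cnorm (p3 d) <= M / th) /\
    forall p', U p' ->
      Cnorm (Csub (Csub (F p') (F p)) (linear3 d p p')) <= M / th ^ 2 * dist3 p p' ^ 2.
Proof.
  intros Hth (M0 & M1 & M2 & (H0 & H1 & H2) & HM & HF) Hp.
  destruct (HF p Hp) as [_ (d & (D1 & D2 & D3) & HD)].
  pose proof (Rmult_le_pos _ _ (Rlt_le _ _ Hth) H1).
  pose proof (Rmult_le_pos _ _ (pow2_ge_0 th) H2).
  assert (Ht2 : 0 < th ^ 2) by (apply pow_lt; auto).
  assert (B1 : M1 <= M / th).
  { apply Rmult_le_reg_l with th; auto. replace (th * (M / th)) with M by (field; lra). lra. }
  assert (B2 : M2 <= M / th ^ 2).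
  { apply Rmult_le_reg_l with (th ^ 2); auto.
    replace (th ^ 2 * (M / th ^ 2)) with M by (field; lra). lra. }
  exists d. split; [lra|]. intros p' Hp'. destruct (HD p' Hp') as [_ HR].
  eapply Rle_trans; [exact HR|]. apply Rmult_le_compat_r; auto using pow2_ge_0.
Qed.

(** The increments have differentials bounded by A 2^-N / th and second-order remainders bounded by
    A 2^-N / th^2. The differentials therefore converge and the remainder constants sum to a finite
    K, so the Taylor estimate passes to the limit with the limiting differential. *)
Lemma Nm_limit U th (G : nat -> C3 -> Cx) A0 A :
  0 < th -> Nm U th (G O) A0 ->
  (forall N, Nm U th (fun p => Csub (G (S N) p) (G N p)) (A * (1 / 2) ^ N)) ->
  exists f : C3 -> Cx,
    (forall N p, U p -> Cnorm (Csub (G N p) (f p)) <= 2 * A * (1 / 2) ^ N) /\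
    exists K, 0 <= K /\ forall p, U p -> exists d : C3, forall p', U p' ->
      Cnorm (Csub (Csub (f p') (f p)) (linear3 d p p')) <= K * dist3 p p' ^ 2.
Proof.
  intros Hth H0 HN.
  assert (HA0 : 0 <= A0) by (apply (Nm_ge0 U th (Rlt_le _ _ Hth)) in H0; auto).
  assert (HA : 0 <= A).
  { specialize (HN O). apply Nm_ge0 in HN; [|lra]. simpl in HN. lra. }
  assert (Hlim : forall p, exists l, U p -> forall N, Cnorm (Csub (G N p) l) <= 2 * A * (1 / 2) ^ N).
  (* Outside [U] nothing is claimed of the limit function, and any value serves. *)
  { intros p. destruct (classic (U p)) as [Hp|Hp]; [|exists Czero; tauto].
    destruct (Cx_geometric_limit (fun N => G N p) A) as [l Hl]; [|exists l; auto].
    intros N. destruct (HN N) as (M0 & M1 & M2 & (P0 & P1 & P2) & HM & HT).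
    destruct (HT p Hp) as [HF _].
    pose proof (Rmult_le_pos _ _ (Rlt_le _ _ Hth) P1).
    pose proof (Rmult_le_pos _ _ (pow2_ge_0 th) P2). lra. }
  destruct (choice _ Hlim) as [f Hf]. exists f.
  split; [intros N p Hp; apply Hf; auto|].
  assert (Ht2 : 0 < th ^ 2) by (apply pow_lt; auto).
  exists (A0 / th ^ 2 + 2 * A / th ^ 2).
  assert (Q1 : 0 <= A / th ^ 2) by (apply Rmult_le_pos; [|left; apply Rinv_0_lt_compat]; auto).
  assert (Q0 : 0 <= A0 / th ^ 2) by (apply Rmult_le_pos; [|left; apply Rinv_0_lt_compat]; auto).
  split; [lra|].
  intros p Hp.
  destruct (Nm_remainder U th _ _ p Hth H0 Hp) as (d0 & _ & R0).
  destruct (choice _ (fun N => Nm_remainder U th _ _ p Hth (HN N) Hp)) as [dd Hdd].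
  (* A differential of [G N]: that of [G O] plus those of the increments. *)
  pose (ee := fix ee N := match N with O => d0 | S j => dadd3 (ee j) (dd j) end).
  assert (HR : forall N p', U p' ->
    Cnorm (Csub (Csub (G N p') (G N p)) (linear3 (ee N) p p')) <=
      (A0 / th ^ 2 + 2 * A / th ^ 2 * (1 - (1 / 2) ^ N)) * dist3 p p' ^ 2).
  { intros N p' Hp'. induction N.
    - simpl ee. replace (A0 / th ^ 2 + 2 * A / th ^ 2 * (1 - (1 / 2) ^ 0)) with (A0 / th ^ 2)
        by (simpl; lra). auto.
    - destruct (Hdd N) as [_ HdN]. specialize (HdN p' Hp').
      replace (Csub (Csub (G (S N) p') (G (S N) p)) (linear3 (ee (S N)) p p')) with
       (Cadd (Csub (Csub (G N p') (G N p)) (linear3 (ee N) p p'))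
         (Csub (Csub (Csub (G (S N) p') (G N p')) (Csub (G (S N) p) (G N p)))
            (linear3 (dd N) p p')))
       by (simpl ee; unfold linear3, dadd3, p1, p2, p3; simpl; ring).
      eapply Rle_trans; [apply Cnorm_add|].
      eapply Rle_trans; [apply Rplus_le_compat; [exact IHN | exact HdN]|].
      apply Req_le. simpl. field. lra. }
  assert (Hlin : forall pr : C3 -> Cx, pr = p1 \/ pr = p2 \/ pr = p3 ->
    exists l, forall N, Cnorm (Csub (pr (ee N)) l) <= 2 * (A / th) * (1 / 2) ^ N).
  { intros pr Hpr. apply Cx_geometric_limit. intros N.
    replace (Csub (pr (ee (S N))) (pr (ee N))) with (pr (dd N)).
    - replace (A / th * (1 / 2) ^ N) with (A * (1 / 2) ^ N / th) by (field; lra).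
      destruct (Hdd N) as [(B1 & B2 & B3) _]. destruct Hpr as [-> | [-> | ->]]; auto.
    - destruct Hpr as [-> | [-> | ->]]; simpl ee; unfold dadd3, p1, p2, p3; simpl; ring. }
  destruct (Hlin p1 ltac:(auto)) as [l1 Hl1]. destruct (Hlin p2 ltac:(auto)) as [l2 Hl2].
  destruct (Hlin p3 ltac:(auto)) as [l3 Hl3].
  exists (l1, l2, l3). intros p' Hp'.
  (* Errors at stage N: 2 A 2^-N at each of the two points, and the distance of the differential
     [ee N] from its limit. *)
  apply (le_of_half_pow _ _ (4 * A + 2 * (A / th) * dist3 p p')). intros N.
  specialize (HR N p' Hp'). pose proof (Hf p Hp N) as Hfp. pose proof (Hf p' Hp' N) as Hfp'.
  pose proof (half_pow_pos N) as Hh.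
  assert (HL : Cnorm (linear3 (dsub3 (ee N) (l1, l2, l3)) p p') <=
             2 * (A / th) * (1 / 2) ^ N * dist3 p p').
  { apply linear3_le; unfold dsub3; [apply Hl1 | apply Hl2 | apply Hl3]. }
  match goal with |- Cnorm ?z <= _ => replace z with
    (Cadd (Cadd (Csub (Csub (G N p') (G N p)) (linear3 (ee N) p p'))
       (linear3 (dsub3 (ee N) (l1, l2, l3)) p p'))
       (Csub (Csub (G N p) (f p)) (Csub (G N p') (f p'))))
    by (unfold linear3, dsub3, p1, p2, p3; simpl; ring) end.
  eapply Rle_trans; [apply Cnorm_add|].
  eapply Rle_trans; [apply Rplus_le_compat; [apply Cnorm_add | apply Cnorm_sub]|].
  assert ((A0 / th ^ 2 + 2 * A / th ^ 2 * (1 - (1 / 2) ^ N)) * dist3 p p' ^ 2 <=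
          (A0 / th ^ 2 + 2 * A / th ^ 2) * dist3 p p' ^ 2).
  { apply Rmult_le_compat_r; [apply pow2_ge_0|].
    assert (0 <= A / th ^ 2 * (1 / 2) ^ N) by (apply Rmult_le_pos; lra).
    unfold Rdiv in *. lra. }
  lra.
Qed.

Lemma holomorphic_of_remainder (U : C3 -> Prop) (f : C3 -> Cx) K :
  0 <= K ->
  (forall p, U p -> exists r, 0 < r /\ forall h1 h2 h3,
     Cnorm h1 < r -> Cnorm h2 < r -> Cnorm h3 < r ->
     U (Cadd (p1 p) h1, Cadd (p2 p) h2, Cadd (p3 p) h3)) ->
  (forall p, U p -> exists d : C3, forall p', U p' ->
     Cnorm (Csub (Csub (f p') (f p)) (linear3 d p p')) <= K * dist3 p p' ^ 2) ->
  holomorphic_on3 (fun z1 z2 l => U (z1, z2, l)) (fun z1 z2 l => f (z1, z2, l)).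
Proof.
  intros HK Hop HU z1 z2 z3 Hz. destruct (HU _ Hz) as [d Hd].
  exists (p1 d), (p2 d), (p3 d). intros eps He.
  destruct (Hop _ Hz) as (r & Hr & HUr). unfold p1, p2, p3 in HUr; simpl in HUr.
  (* With s the sum of the three increments, s <= 3 delta, so K s^2 <= 3 K delta s <= eps s. *)
  assert (Hq : 0 < eps / (3 * K + 1)) by (apply Rdiv_lt_0_compat; lra).
  exists (Rmin r (eps / (3 * K + 1))). split; [apply Rmin_glb_lt; auto|].
  intros h1 h2 h3 H1 H2 H3.
  pose proof (Rmin_l r (eps / (3 * K + 1))). pose proof (Rmin_r r (eps / (3 * K + 1))).
  specialize (Hd _ (HUr h1 h2 h3 ltac:(lra) ltac:(lra) ltac:(lra))).
  unfold linear3, dist3, p1, p2, p3 in Hd; simpl in Hd.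
  assert (E : forall z h, Csub (Cadd z h) z = h) by (intros; ring).
  rewrite !E in Hd. fold (p1 d) (p2 d) (p3 d) in Hd.
  eapply Rle_trans; [exact Hd|].
  pose proof (Cnorm_ge0 h1). pose proof (Cnorm_ge0 h2). pose proof (Cnorm_ge0 h3).
  set (s := Cnorm h1 + Cnorm h2 + Cnorm h3) in *.
  assert (Hs : s <= 3 * (eps / (3 * K + 1))) by (unfold s; lra).
  assert (Hs0 : 0 <= s) by (unfold s; lra).
  assert (K * s <= eps).
  { apply Rle_trans with (K * (3 * (eps / (3 * K + 1)))); [apply Rmult_le_compat_l; auto|].
    apply Rle_trans with ((3 * K + 1) * (eps / (3 * K + 1))); [lra|].
    right. field. lra. }
  nra.
Qed.

Lemma sum_half_pow n : sum_f_R0 (fun k => (1 / 2) ^ k) n <= 2.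
Proof.
  assert (E : sum_f_R0 (fun k => (1 / 2) ^ k) n = 2 - (1 / 2) ^ n).
  { induction n; [simpl; lra|]. rewrite tech5, IHn. simpl. lra. }
  rewrite E. pose proof (half_pow_pos n). lra.
Qed.

Lemma Csum_add f g n : Csum (fun k => Cadd (f k) (g k)) n = Cadd (Csum f n) (Csum g n).
Proof. rewrite !Csum_psum. apply (psum_add _ _ _ _ _ _ _ (F_R Cx_field_theory)). Qed.

(** A square partial sum grows by an L-shaped border: the new column over the old rows, then the
    full new row. *)
Lemma psum2_step X N z1 z2 :
  let T n m := Cmul (X n m) (Cmul (Cpow z1 n) (Cpow z2 m)) in
  Csub (psum2 X (S N) z1 z2) (psum2 X N z1 z2) =
  Cadd (Csum (fun n => T n (S N)) N) (Csum (fun m => T (S N) m) (S N)).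
Proof.
  intros T.
  transitivity (Csub
    (Cadd (Csum (fun n => Cadd (Csum (fun m => T n m) N) (T n (S N))) N)
          (Csum (fun m => T (S N) m) (S N)))
    (Csum (fun n => Csum (fun m => T n m) N) N)); [reflexivity|].
  rewrite Csum_add. ring.
Qed.

(** * Uniform bounds on relatively compact parameter sets *)

(** A compactness argument on the square of side 2B, which contains [L]. Each of its points is
    either at positive distance from [L], or in the closure of [L] and so strictly inside the
    annulus; both alternatives are recorded by one radius [dl]. *)
Lemma annulus_margin xi (L : Cx -> Prop) :
  xi <> Czero -> (forall z, C_closure L z -> L0 xi z) ->
  exists d, 0 < d <= / Cnorm xi /\
    forall z, L z -> 1 + d <= Cnorm z /\ Cnorm z + d <= / Cnorm xi.
Proof.
  intros Hxi HL. set (B := / Cnorm xi).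
  assert (HB : 0 < B) by (apply Rinv_0_lt_compat, Cnorm_gt0; auto).
  assert (Hdel : forall uv : R * R, exists dl : posreal,
     (forall w, L w -> 2 * dl <= Cnorm (Csub w (mkC (fst uv) (snd uv)))) \/
     (1 + 4 * dl <= Cnorm (mkC (fst uv) (snd uv)) /\
      Cnorm (mkC (fst uv) (snd uv)) + 4 * dl <= B)).
  { intros uv. set (z := mkC (fst uv) (snd uv)).
    destruct (classic (C_closure L z)) as [Hz|Hz].
    - destruct (HL z Hz) as [Z1' Z2']. fold B in Z2'.
      assert (P : 0 < Rmin (Cnorm z - 1) (B - Cnorm z) / 4).
      { apply Rdiv_lt_0_compat; [apply Rmin_glb_lt|]; lra. }
      exists (mkposreal _ P). right. simpl.
      pose proof (Rmin_l (Cnorm z - 1) (B - Cnorm z)).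
      pose proof (Rmin_r (Cnorm z - 1) (B - Cnorm z)). lra.
    - apply not_all_ex_not in Hz. destruct Hz as [eps Hz].
      apply imply_to_and in Hz. destruct Hz as [He Hz].
      exists (mkposreal (eps / 2) ltac:(lra)). left. intros w Hw. simpl.
      destruct (Rle_lt_dec eps (Cnorm (Csub w z))) as [H|H]; [lra|].
      exfalso. apply Hz. exists w. auto. }
  destruct (choice _ Hdel) as [dl Hdl].
  (* Every w in [L] is close to a centre z whose radius is at least [d]. Real and imaginary parts
     differ by less than [dl], so |w - z| < 2 dl: the far alternative is excluded, and the margin 4
     dl at z leaves 2 dl at w. *)
  destruct (Compactness.compactness_value_2d (- B) B (- B) B (fun u v => dl (u, v))) as [d Hd].
  (* The minimum with B keeps B - d nonnegative, as is required when it serves as a bound for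
     |Lam|. *)
  exists (Rmin d B). pose proof (cond_pos d) as Pd.
  pose proof (Rmin_l d B). pose proof (Rmin_r d B).
  split; [split; [apply Rmin_glb_lt; auto | auto]|].
  intros w Hw.
  assert (Hw0 : L0 xi w).
  { apply HL. intros eps He. exists w. split; auto.
    replace (Csub w w) with Czero by ring. rewrite Cnorm_0. auto. }
  destruct Hw0 as [W1 W2]. fold B in W2.
  pose proof (re_le_Cnorm w) as Wr. pose proof (im_le_Cnorm w) as Wi.
  assert (Rabs_between : forall x y, Rabs x <= y -> - y <= x <= y).
  { intros x y H'. unfold Rabs in H'. destruct (Rcase_abs x); lra. }
  apply Rabs_between in Wr, Wi.
  specialize (Hd (re w) (im w) ltac:(lra) ltac:(lra)). apply NNPP in Hd.
  destruct Hd as (u & v & _ & _ & Hu & Hv & Hdd).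
  set (z := mkC u v).
  assert (Hwz : Cnorm (Csub w z) < 2 * dl (u, v)).
  { eapply Rle_lt_trans; [apply Cnorm_le_re_im|]. simpl. unfold Rminus in *. lra. }
  destruct (Hdl (u, v)) as [Hfar | [Hlo Hhi]].
  all: cbn [fst snd] in *.
  { specialize (Hfar w Hw). fold z in Hfar. lra. }
  fold z in Hlo, Hhi.
  pose proof (Cnorm_add (Csub w z) z) as T1. replace (Cadd (Csub w z) z) with w in T1 by ring.
  pose proof (Cnorm_sub w (Csub w z)) as T2. replace (Csub w (Csub w z)) with z in T2 by ring.
  lra.
Qed.

Lemma L0_q_lt1 xi Lam : xi <> Czero -> L0 xi Lam ->
  Lam <> Czero /\ Cnorm (Cmul xi Lam) < 1 /\ Cnorm (Cinv Lam) < 1.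
Proof.
  intros Hxi [H1 H2]. pose proof (Cnorm_gt0 xi Hxi) as Hx.
  assert (HL : Lam <> Czero) by (intros E; rewrite E, Cnorm_0 in H1; lra).
  split; [auto|]. split.
  - rewrite Cnorm_mul. apply Rmult_lt_compat_l with (r := Cnorm xi) in H2; auto.
    rewrite Rinv_r in H2; lra.
  - rewrite Cnorm_inv by auto. rewrite <- Rinv_1. apply Rinv_lt_contravar; lra.
Qed.

Lemma L0_nonresonant xi Lam : xi <> Czero -> L0 xi Lam -> nonresonant Lam xi.
Proof.
  intros Hxi HL m n Hmn E. destruct (L0_q_lt1 xi Lam Hxi HL) as (_ & H1 & H2).
  apply (f_equal Cnorm) in E. rewrite Cnorm_mul, !Cnorm_pow, Cnorm_1 in E.
  pose proof (Cnorm_ge0 (Cmul xi Lam)) as P1. pose proof (Cnorm_ge0 (Cinv Lam)) as P2.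
  assert (K : forall x j, 0 <= x < 1 -> 0 <= x ^ j <= 1 /\ (j <> O -> x ^ j < 1)).
  { intros x j Hx. split.
    - split; [apply pow_le; lra | rewrite <- (pow1 j); apply pow_incr; lra].
    - intros Hj. apply pow_lt_1_compat; [lra | lia]. }
  destruct (K _ m (conj P1 H1)) as [B1 S1]. destruct (K _ n (conj P2 H2)) as [B2 S2].
  destruct m; [destruct n; [congruence|]|].
  - specialize (S2 ltac:(lia)). simpl in *. lra.
  - specialize (S1 ltac:(lia)). nra.
Qed.

(** * Convergence near the origin and joint holomorphy *)

Section Convergence.

Variables (xi a b c d : Cx) (L : Cx -> Prop).
Hypotheses (Hxi : xi <> Czero) (Hxi1 : Cnorm xi < 1).
Hypothesis HL : forall z, C_closure L z -> L0 xi z.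

(** The majorant argument requires the norms of q1 and q2, derivative terms in Lam included, to be
    below 1. The margin of [L] inside the annulus bounds the moduli by some rho0 < 1, and a small th
    then keeps the full norms below 1. *)
Lemma Nm_xsol_params : exists th A r, 0 < th /\ 0 < A /\ 1 <= r /\ forall n m,
  Nm (fun p => L (p3 p)) th (fun p => xsol (params (p3 p) xi a b c d) n m) (A * r ^ (n + m)).
Proof.
  destruct (annulus_margin xi L Hxi HL) as (dl & Hd & HLd).
  pose proof (Cnorm_gt0 xi Hxi) as Hx. set (B := / Cnorm xi) in *.
  assert (EB : Cnorm xi * B = 1) by (unfold B; field; lra).
  pose (rho0 := Rmax (/ (1 + dl)) (1 - dl * Cnorm xi)).
  assert (R1 : / (1 + dl) <= rho0) by apply Rmax_l.
  assert (R2 : 1 - dl * Cnorm xi <= rho0) by apply Rmax_r.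
  assert (R3 : 0 < / (1 + dl)) by (apply Rinv_0_lt_compat; lra).
  assert (R4 : rho0 < 1).
  { apply Rmax_lub_lt; [rewrite <- Rinv_1; apply Rinv_lt_contravar; lra|].
    assert (0 < dl * Cnorm xi) by (apply Rmult_lt_0_compat; lra). lra. }
  (* rho is the midpoint of rho0 and 1, that is rho0 + 2 th: for 1/Lam the derivative terms add th +
     th^2 <= 2 th, for xi Lam they add |xi| th <= th. *)
  pose (th := (1 - rho0) / 4). pose (rho := (1 + rho0) / 2).
  assert (Hth : 0 < th < 1) by (unfold th; lra).
  assert (Ht0 : 0 <= th) by lra.
  set (U := fun p => L (p3 p)).
  assert (N3 : Nm U th p3 (B - dl + th)).
  { apply Nm_coord; [auto | lra|]. intros p Hp. destruct (HLd _ Hp). lra. }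
  assert (HU : forall p, U p -> p3 p <> Czero /\ / Cnorm (p3 p) <= / (1 + dl)).
  { intros p Hp. destruct (HLd _ Hp) as [H1 _]. split.
    - intros E. rewrite E, Cnorm_0 in H1. lra.
    - apply Rinv_le_contravar; lra. }
  assert (NI : Nm U th (fun p => Cinv (p3 p)) rho).
  { apply Nm_mono with (/ (1 + dl) + th + th ^ 2).
    - assert (th ^ 2 <= th) by (simpl; nra). unfold rho. unfold th in *. lra.
    - apply Nm_inv_p3; [lra | auto]. }
  assert (NQ : Nm U th (fun p => Cmul xi (p3 p)) rho).
  { apply Nm_mono with (Cnorm xi * (B - dl + th)).
    - replace (Cnorm xi * (B - dl + th)) with (1 - dl * Cnorm xi + Cnorm xi * th)
        by (rewrite <- EB; ring).
      assert (Cnorm xi * th <= th) by nra. unfold rho, th in *. lra.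
    - apply Nm_mul; auto. apply (Nm_const U th xi). }
  destruct (Nm_xsol U th Ht0 (fun p => params (p3 p) xi a b c d) rho) as (A & r & HA & Hr & H).
  - unfold rho. lra.
  - assert (Kc : forall z, exists K, Nm U th (fun _ => z) K) by (intros z; exists (Cnorm z); apply Nm_const).
    intros k. destruct k as [|[|[|[|[|[|[|[|[|k]]]]]]]]]; simpl; try apply Kc.
    + exists rho. exact NQ.
    + exists rho. exact NI.
    (* 1/q1 may be large, but it enters only as a coefficient and never as a dilation, so any finite
       bound will do. *)
    + exists (Cnorm (Cinv xi) * rho).
      apply Nm_ext with (fun p => Cmul (Cinv xi) (Cinv (p3 p))).
      * intros p Hp. symmetry. apply Cinv_mul; auto. apply HU; auto.
      * apply Nm_mul; auto. apply (Nm_const U th (Cinv xi)).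
  - exact NQ.
  - exact NI.
  - exists th, A, r. repeat split; auto; lra.
Qed.

Lemma xsol_convergent : C_open L ->
  exists Z : Cx -> Cx -> Prop, C2_open Z /\ Z Czero Czero /\
  exists f : Cx -> Cx -> Cx -> Cx,
    holomorphic_on3 (fun z1 z2 l => Z z1 z2 /\ L l) f /\
    unif_conv3 (fun z1 z2 l => Z z1 z2 /\ L l)
      (fun N z1 z2 l => psum2 (fun n m => xsol (params l xi a b c d) n m) N z1 z2) f.
Proof.
  intros HLo. destruct Nm_xsol_params as (th & A & r & Hth & HA & Hr & HX).
  (* On |zeta| < eta a coordinate has norm at most eta + th' <= 2 eta once th is shrunk to [th'],
     and r * 2 eta = 1/2 bounds the term (n,m) of the series by A 2^-(n+m). *)
  pose (eta := / (4 * r)).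
  assert (Heta : 0 < eta) by (apply Rinv_0_lt_compat; lra).
  assert (Er : r * (eta + eta) = 1 / 2) by (unfold eta; field; lra).
  pose (th' := Rmin th eta).
  assert (Hth' : 0 < th' <= th) by (split; [apply Rmin_glb_lt; auto | apply Rmin_l]).
  assert (Hth'' : th' <= eta) by apply Rmin_r.
  assert (Ht0 : 0 <= th') by lra.
  assert (Hopen : forall z, Cnorm z < eta -> exists s, 0 < s /\
            forall w, Cnorm (Csub w z) < s -> Cnorm w < eta).
  { intros z Hz. exists (eta - Cnorm z). split; [lra|]. intros w Hw.
    pose proof (Cnorm_add (Csub w z) z) as T. replace (Cadd (Csub w z) z) with w in T by ring. lra. }
  exists (fun z1 z2 => Cnorm z1 < eta /\ Cnorm z2 < eta).
  split; [|split; [rewrite Cnorm_0; auto|]].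
  { intros z1 z2 [H1 H2]. destruct (Hopen z1 H1) as (s1 & P1 & O1).
    destruct (Hopen z2 H2) as (s2 & P2 & O2).
    exists (Rmin s1 s2). split; [apply Rmin_glb_lt; auto|].
    pose proof (Rmin_l s1 s2). pose proof (Rmin_r s1 s2).
    intros w1 w2 W1 W2. split; [apply O1 | apply O2]; lra. }
  set (U := fun p => (Cnorm (p1 p) < eta /\ Cnorm (p2 p) < eta) /\ L (p3 p)).
  pose (X := fun p : C3 => fun n m => xsol (params (p3 p) xi a b c d) n m).
  pose (T := fun n m (p : C3) => Cmul (X p n m) (Cmul (Cpow (p1 p) n) (Cpow (p2 p) m))).
  assert (HT : forall n m, Nm U th' (T n m) (A * (1 / 2) ^ (n + m))).
  { intros n m.
    replace (A * (1 / 2) ^ (n + m)) with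
      ((A * r ^ (n + m)) * ((eta + eta) ^ n * (eta + eta) ^ m)).
    - assert (Nc : forall pr, pr = p1 \/ pr = p2 -> Nm U th' pr (eta + eta)).
      { intros pr Hpr. apply Nm_mono with (eta + th'); [lra|].
        apply Nm_coord; [tauto | lra|]. intros p [[B1 B2] _].
        destruct Hpr as [-> | ->]; lra. }
      apply Nm_mul; auto; [|apply Nm_mul; auto; apply Nm_pow; auto].
      apply (Nm_restrict (fun p => L (p3 p)) th); [intros p [_ Hp]; exact Hp | lra | apply HX].
    - rewrite <- Er, <- pow_add, Rpow_mult_distr. ring. }
  destruct (Nm_limit U th' (fun N p => psum2 (X p) N (p1 p) (p2 p)) A (2 * A))
    as (f & Hf & K & HK & HfK); [lra | | |].
  - pose proof (HT O O) as H0. simpl in H0. rewrite Rmult_1_r in H0. exact H0.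
  - intros N.
    apply Nm_ext with (fun p => Cadd (Csum (fun n => T n (S N) p) N) (Csum (fun m => T (S N) m p) (S N))).
    { intros p _. symmetry. apply (psum2_step (X p) N (p1 p) (p2 p)). }
    pose proof (half_pow_pos N) as HN.
    apply Nm_mono with (sum_f_R0 (fun n => A * (1 / 2) ^ (n + S N)) N
       + sum_f_R0 (fun m => A * (1 / 2) ^ (S N + m)) (S N)).
    + rewrite (sum_eq (fun n => A * (1 / 2) ^ (n + S N))
                 (fun n => (1 / 2) ^ n * (A * (1 / 2) ^ S N)))
        by (intros; rewrite pow_add; ring).
      rewrite (sum_eq (fun m => A * (1 / 2) ^ (S N + m))
                 (fun n => (1 / 2) ^ n * (A * (1 / 2) ^ S N)))
        by (intros; rewrite pow_add; ring).
      rewrite <- !scal_sum. pose proof (sum_half_pow N). pose proof (sum_half_pow (S N)).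
      assert (0 < A * (1 / 2) ^ S N) by (apply Rmult_lt_0_compat; [lra | apply half_pow_pos]).
      replace (2 * A * (1 / 2) ^ N) with (A * (1 / 2) ^ S N * 2 + A * (1 / 2) ^ S N * 2)
        by (simpl; field).
      apply Rplus_le_compat; apply Rmult_le_compat_l; auto using Rlt_le.
    + apply Nm_add.
      * apply (Nm_sum U th' (fun n p => T n (S N) p)). intros; apply HT.
      * apply (Nm_sum U th' (fun m p => T (S N) m p)). intros; apply HT.
  - exists (fun z1 z2 l => f (z1, z2, l)). split.
    + apply (holomorphic_of_remainder U f K HK); [|exact HfK].
      intros p [[H1 H2] H3]. destruct (Hopen _ H1) as (s1 & P1 & O1).
      destruct (Hopen _ H2) as (s2 & P2 & O2). destruct (HLo _ H3) as (s3 & P3 & O3).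
      exists (Rmin (Rmin s1 s2) s3).
      pose proof (Rmin_l (Rmin s1 s2) s3). pose proof (Rmin_r (Rmin s1 s2) s3).
      pose proof (Rmin_l s1 s2). pose proof (Rmin_r s1 s2).
      split; [repeat apply Rmin_glb_lt; auto|]. intros h1 h2 h3 B1 B2 B3.
      assert (E : forall z h, Csub (Cadd z h) z = h) by (intros; ring).
      split; [split|]; [apply O1 | apply O2 | apply O3]; unfold p1, p2, p3; simpl;
        rewrite E; lra.
    + intros eps He. destruct (half_pow_small (2 * (2 * A)) eps He) as [N0 HN0].
      exists N0. intros N HN z1 z2 l Hz. eapply Rle_lt_trans; [|apply (HN0 N HN)].
      apply (Hf N (z1, z2, l) Hz).
Qed.

End Convergence.

(* X n m Lam xi a b c d  is the coefficient  x^{0,+}_{n,n-m}(Lam_s, xi, b_s),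
   i.e. the coefficient of t^n phi_s^(n-m). *)
Theorem mainTheorem9 :
  exists X : nat -> nat -> (Cx -> Cx -> Cx -> Cx -> Cx -> Cx -> Cx),
    (* each coefficient is a rational function regular on the non-resonant domain *)
    (forall n m, rational_regular_on Dom (X n m)) /\
    (* at every such parameter it gives the unique normalized formal solution *)
    (forall Lam xi a b c d, Dom Lam xi a b c d ->
       is_xseries (fun n m => X n m Lam xi a b c d) /\
       X 1%nat 0%nat Lam xi a b c d = Cone /\
       qPA1_formal Lam xi a b c d (fun n m => X n m Lam xi a b c d) /\
       (forall y : FS, is_xseries y -> y 1%nat 0%nat = Cone ->
          qPA1_formal Lam xi a b c d y ->
          forall n m, y n m = X n m Lam xi a b c d)) /\
    (* |xi| < 1 and Lam in L_0^s imply the non-resonance condition *)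
    (forall Lam xi, xi <> Czero -> Cnorm xi < 1 -> L0 xi Lam ->
       Lam <> Czero /\ nonresonant Lam xi) /\
    (* convergence *)
    (forall xi a b c d, xi <> Czero -> Cnorm xi < 1 ->
       a <> Czero -> b <> Czero -> c <> Czero -> d <> Czero ->
       forall L : Cx -> Prop, C_open L -> (forall z, C_closure L z -> L0 xi z) ->
       exists Z : Cx -> Cx -> Prop, C2_open Z /\ Z Czero Czero /\
       exists f : Cx -> Cx -> Cx -> Cx,
         holomorphic_on3 (fun z1 z2 l => Z z1 z2 /\ L l) f /\
         unif_conv3 (fun z1 z2 l => Z z1 z2 /\ L l)
           (fun N z1 z2 l => psum2 (fun n m => X n m l xi a b c d) N z1 z2) f).
Proof.
  exists (fun n m Lam xi a b c d => xsol (params Lam xi a b c d) n m).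
  split; [exact RR_xsol|]. split; [|split].
  - intros Lam xi a b c d HD. split; [apply xsol_is_xseries|].
    split; [apply xsol_10|]. split; [apply (xsol_solution _ _ _ _ _ _ HD)|].
    intros y Hy Hy1 Heq n m. rewrite (xsol_unique _ _ _ _ _ _ HD y Hy Hy1 Heq). reflexivity.
  - intros Lam xi Hxi _ HLam. split; [apply (L0_q_lt1 xi Lam Hxi HLam)|].
    apply L0_nonresonant; auto.
  - intros xi a b c d Hxi Hxi1 _ _ _ _ L HLo HLc. apply xsol_convergent; auto.
Qed.
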